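(* Let $q=2^{2n+1}$ with $n\geqslant1$ an integer, let $r=2^{n+1}$, $\alpha_q=q-r+1$ and $\beta_q=q+r+1$. Then the number of spanning trees of the commuting graph of the Suzuki group $\mathrm{Sz}(q)$ is $$\kappa_{\mathcal C}(\mathrm{Sz}(q))=\left(2^{(q-1)^2}q^{\,q^2+q-3}\right)^{q^2+1}(q-1)^{(q-3)a}\,\alpha_q^{(\alpha_q-2)b}\,\beta_q^{(\beta_q-2)c},$$ where $a=q^2(q^2+1)/2$, $b=q^2(q-1)\beta_q/4$ and $c=q^2(q-1)\alpha_q/4$.
   Context: For a finite group $G$, the commuting graph $\mathcal{C}(G)$ has vertex set $G$, two distinct elements being adjacent when they commute. $\kappa_{\mathcal C}(G)$ denotes the number of spanning trees of $\mathcal{C}(G)$. $\mathrm{Sz}(q)$ is the Suzuki simple group of Lie type over the field of $q$ elements. *)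

(* Defs.v *)
From mathcomp Require Import all_boot all_order all_algebra all_fingroup.
Set Implicit Arguments. Unset Strict Implicit. Unset Printing Implicit Defensive.
Import GRing.Theory.
Local Open Scope ring_scope.

Section Graphs.
Variable V : finType.

Definition is_edge (S : {set V}) (adj : rel V) (A : {set V}) : bool :=
  [exists x in S, exists y in S, [&& x != y, adj x y & A == [set x; y]]].

Definition edge_rel (E : {set {set V}}) : rel V :=
  fun x y => [set x; y] \in E.

(* E is a spanning tree of the graph (S, adj): E is a set of edges of the
   graph, the graph (S, E) is connected, and (S, E) is acyclic (no edge of E
   lies on a cycle, i.e. the endpoints of every edge are disconnected once
   that edge is removed). *)
Definition spanning_tree (S : {set V}) (adj : rel V) (E : {set {set V}}) : bool :=
  [&& [forall A in E, is_edge S adj A],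
      [forall x in S, forall y in S, connect (edge_rel E) x y] &
      [forall x in S, forall y in S,
         ([set x; y] \in E) && (x != y) ==>
           ~~ connect (edge_rel (E :\ [set x; y])) x y]].

Definition num_spanning_trees (S : {set V}) (adj : rel V) : nat :=
  #|[set E : {set {set V}} | spanning_tree S adj E]|.
End Graphs.

Definition commuting_adj (gT : finGroupType) : rel gT :=
  fun x y => (x != y) && (x * y == y * x)%g.

Definition kappa_C (gT : finGroupType) (G : {set gT}) : nat :=
  num_spanning_trees G (@commuting_adj gT).

(* ---------- The Suzuki group Sz(q), q = 2^(2n+1) ----------
   Following R.A. Wilson, "The Finite Simple Groups", Sec. 4.2:
   F a field with q = 2^(2n+1) elements, theta : x |-> x^(2^(n+1)),
   Sz(q) = < T(a,b), M(lambda) (lambda <> 0), W > <= GL_4(F). *)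
Section Suzuki.
Variables (F : finFieldType) (n : nat).

Definition sz_theta (x : F) : F := x ^+ (2 ^ n.+1).

Definition sz_T (a b : F) : 'M[F]_4 :=
  \matrix_(i < 4, j < 4)
    match nat_of_ord i, nat_of_ord j with
    | 0, 0 => 1 | 1, 1 => 1 | 2, 2 => 1 | 3, 3 => 1
    | 1, 0 => a
    | 2, 0 => b | 2, 1 => sz_theta a
    | 3, 0 => a ^+ 2 * sz_theta a + a * b + sz_theta b
    | 3, 1 => a * sz_theta a + b
    | 3, 2 => a
    | _, _ => 0
    end.

Definition sz_M (l : F) : 'M[F]_4 :=
  \matrix_(i < 4, j < 4)
    if i == j then
      match nat_of_ord i with
      | 0 => l ^+ (1 + 2 ^ n)
      | 1 => l ^+ (2 ^ n)
      | 2 => l ^- (2 ^ n)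
      | _ => l ^- (1 + 2 ^ n)
      end
    else 0.

Definition sz_W : 'M[F]_4 :=
  \matrix_(i < 4, j < 4) if (i + j == 3)%N then 1 else 0.

Definition sz_gen (A : 'M[F]_4) : bool :=
  [|| [exists a : F, exists b : F, A == sz_T a b],
      [exists l : F, (l != 0) && (A == sz_M l)] | A == sz_W].

Definition Suzuki : {set {'GL_4[F]}} :=
  <<[set x : {'GL_4[F]} | sz_gen (GLval x)]>>%g.
End Suzuki.

Definition sz_q (n : nat) : nat := 2 ^ (2 * n + 1).
Definition sz_r (n : nat) : nat := 2 ^ n.+1.
Definition sz_alpha (n : nat) : nat := sz_q n - sz_r n + 1.
Definition sz_beta (n : nat) : nat := sz_q n + sz_r n + 1.

(* Main.v *)
(* The nontrivial elements of G = Sz(q) fall into four families of subgroups A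
   with 'C_G[x] contained in A for every x <> 1 in A: the conjugates of the
   Sylow 2-subgroup U (order q^2), of the torus H (order q - 1), and of two
   abelian groups of orders alpha_q and beta_q. Distinct members meet trivially,
   so the commuting graph is a union of the graphs C(A) glued at the vertex 1,
   and by the matrix-tree theorem the number of spanning trees is the product
   of the numbers for the C(A). For A abelian this is Cayley's m^(m-2); for U it
   is a determinant, as T(a,b) and T(c,d) commute iff a = 0, c = 0 or a = c.

   Only the last two families need work. Let R be the set of elements x <> 1 in
   no conjugate of the Borel subgroup B = UH. By the Bruhat decomposition each
   x in R is conjugate to some T(a,b)W, a matrix with a cyclic vector, so 'C_G[x]
   is abelian, and x is a root of a quartic whose other roots include its
   conjugates in 'C_G[x], so there are at most four of these. Thus the groups
   'C_G[x] for x in R intersect trivially, their orders are pairwise coprime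
   across conjugacy classes, divide q^2 + 1 and exceed 4, and their index in
   their normaliser is 1, 2 or 4, as 3 does not divide |G|. Comparing with |R|
   forces exactly two classes, of index 4, whose orders have product q^2 + 1 and
   sum 2(q + 1). *)
Require Import Defs.
From mathcomp Require Import all_boot all_order all_algebra all_fingroup all_solvable all_field.
From mathcomp Require Import zify ring.
Set Implicit Arguments. Unset Strict Implicit. Unset Printing Implicit Defensive.
Import GRing.Theory Num.Theory.

(** * Spanning trees and parent functions *)

(** The groups of orders [alpha_q] and [beta_q] are not built as explicit tori: they arise as
    centralisers, and counting fixes their orders. The count rests on the bound of four for
    conjugates inside a centraliser, and there the roots of the quartic are matrices. In a
    noncommutative ring a quartic can have more than four roots; the bound survives for roots that
    commute pairwise and have invertible differences. Commutation comes from the abelian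
    centraliser. A difference [GLval y - GLval z] is singular only if [y^-1 * z] fixes a nonzero
    vector, so everything hinges on elements of [R] fixing none. This follows from the shape
    [1, s, th s, s, 1] of the coefficients: at 1 the quartic takes the value [th s], so a fixed
    vector forces [s = 0] and [z ^+ 4 = 1], while elements of [R] have order prime to that of [B].
    The same fact yields the cyclic vector, as an eigenvector over [F] would be fixed by the power
    [q - 1]. *)

Lemma connect_invariant (T : finType) (e : rel T) (D : pred T) (x y : T) :
  (forall u v, e u v -> D u -> D v) -> connect e x y -> D x -> D y.
Proof.
move=> De /connectP[p + ->]; elim: p x => [|z p IHp] x //= /andP[xz zp] Dx.
by apply: IHp zp _; apply: De xz Dx.
Qed.

Section ParentFunctions.
Variables (V : finType) (S : {set V}) (adj : rel V) (r : V).
Hypotheses (Sr : r \in S) (adj_sym : symmetric adj) (adj_irr : irreflexive adj).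

(** Sending the root and all points outside [S] to [r] leaves exactly one function on the whole type
    for each rooted tree. *)
Definition parent_fun (f : {ffun V -> V}) :=
  [forall x, if x \in S :\ r then (f x \in S) && adj x (f x) else f x == r].

Definition rooted (f : {ffun V -> V}) := [forall x, fconnect f x r].

Definition parent_edges (f : {ffun V -> V}) : {set {set V}} :=
  [set [set x; f x] | x in S :\ r].

Lemma parent_funP f x : parent_fun f -> x \in S :\ r -> (f x \in S) && adj x (f x).
Proof. by move=> /forallP/(_ x) + xS; rewrite xS. Qed.

Lemma parent_fun_out f x : parent_fun f -> x \notin S :\ r -> f x = r.
Proof. by move=> /forallP/(_ x) + /negPf xS; rewrite xS => /eqP. Qed.

Lemma parent_fun_root f : parent_fun f -> f r = r.
Proof. by move=> pf; apply: parent_fun_out pf _; rewrite !inE eqxx. Qed.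

Lemma iter_root f k : parent_fun f -> iter k f r = r.
Proof. by move=> pf; elim: k => //= k ->; apply: parent_fun_root. Qed.

(** A periodic point returns to itself after a multiple of its period that is large enough for it to
    have reached the fixed point [r]. *)
Lemma rooted_acyclic f x k :
  parent_fun f -> rooted f -> iter k.+1 f x = x -> x = r.
Proof.
move=> pf /forallP/(_ x)/iter_findex; set m := findex _ _ _ => rm xk.
have: iter (m * k.+1) f x = x by elim: (m) => // i IHi; rewrite mulSn iterD IHi.
by rewrite mulnS addnC iterD rm iter_root.
Qed.

Lemma edge_rel_sym (E : {set {set V}}) : symmetric (edge_rel E).
Proof. by move=> x y; rewrite /edge_rel setUC. Qed.

Lemma set2_inj (x y u v : V) : [set x; y] = [set u; v] ->
  (x = u /\ y = v) \/ (x = v /\ y = u).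
Proof.
move=> e.
have := set21 x y; rewrite e !inE => /orP[]/eqP xE; rewrite {x}xE in e *.
  have := set22 u y; rewrite e !inE => /orP[]/eqP yE; last by left.
  rewrite {y}yE in e *; have := set22 u v; rewrite -e !inE orbb => /eqP->; by left.
have := set22 v y; rewrite e !inE => /orP[]/eqP yE; first by right.
rewrite {y}yE in e *; have := set21 u v; rewrite -e !inE orbb => /eqP->; by left.
Qed.

Lemma parent_edges_connect f x : parent_fun f -> rooted f -> x \in S ->
  connect (edge_rel (parent_edges f)) x r.
Proof.
move=> pf /forallP/(_ x)/iter_findex; move: (findex _ _ _) => k.
elim: k x => [|k IHk] x; first by move=> /= ->; rewrite connect0.
rewrite iterSr => fxr xS; have [->|xr] := eqVneq x r; first by rewrite connect0.
have xS' : x \in S :\ r by rewrite !inE xr.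
have /andP[fxS _] := parent_funP pf xS'.
apply: connect_trans (IHk _ fxr fxS); apply: connect1.
by apply/imsetP; exists x.
Qed.

Lemma parent_edges_tree f : parent_fun f -> rooted f ->
  spanning_tree S adj (parent_edges f).
Proof.
move=> pf rf; apply/and3P; split.
- apply/forallP => A; apply/implyP => /imsetP[x xS ->].
  have /andP[fxS xfx] := parent_funP pf xS.
  apply/existsP; exists x; rewrite (subsetP (subD1set _ _) _ xS) /=.
  apply/existsP; exists (f x); rewrite fxS xfx eqxx !andbT /=.
  by apply: contraTneq xfx => <-; rewrite adj_irr.
- apply/forallP => x; apply/implyP => xS; apply/forallP => y; apply/implyP => yS.
  apply: connect_trans (parent_edges_connect pf rf xS) _.
  by rewrite (sym_connect_sym (@edge_rel_sym _)); apply: parent_edges_connect.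
(* Once the edge from [z] to [f z] is removed, the remaining edges preserve the set of vertices
   whose iterates reach [z]. It contains [z]; if it contained [f z], then [z] would be periodic. *)
have cut z : z \in S :\ r ->
  ~~ connect (edge_rel (parent_edges f :\ [set z; f z])) z (f z).
  move=> zS; apply/negP => zfz.
  suff: fconnect f (f z) z.
    move=> /iter_findex; rewrite -iterSr => /(rooted_acyclic pf rf) zr.
    by rewrite zr !inE eqxx in zS.
  apply: (connect_invariant (D := fun u => fconnect f u z)) zfz (connect0 _ _).
  move=> u v; rewrite /edge_rel !inE => /andP[uv /imsetP[w wS uvw]].
  have wz : w != z by apply: contraNneq uv => <-; rewrite uvw.
  have fw : fconnect f w z = fconnect f (f w) z.
    apply/idP/idP; last by apply: connect_trans; apply: fconnect1.
    move=> /iter_findex; case: (findex _ _ _) => [/= wz'|k].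
      by rewrite wz' eqxx in wz.
    by rewrite iterSr => <-; apply: fconnect_iter.
  by case: (set2_inj uvw) => [] [-> ->]; rewrite fw.
apply/forallP => x; apply/implyP => xS; apply/forallP => y; apply/implyP => yS.
apply/implyP => /andP[/imsetP[z zS xyz] xy]; rewrite xyz.
case: (set2_inj xyz) => [] [-> ->]; first exact: cut.
by rewrite (sym_connect_sym (@edge_rel_sym _)); apply: cut.
Qed.

Lemma parent_edges_inj :
  {in [pred f | parent_fun f && rooted f] &, injective parent_edges}.
Proof.
move=> f g; rewrite !inE => /andP[pf rf] /andP[pg _] efg; apply/ffunP => x.
have [xS|xS] := boolP (x \in S :\ r); last first.
  by rewrite (parent_fun_out pf xS) (parent_fun_out pg xS).
have edge_g y : y \in S :\ r -> f y = g y \/ (f y \in S :\ r /\ g (f y) = y).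
  move=> yS; have: [set y; f y] \in parent_edges g.
    by rewrite -efg; apply/imsetP; exists y.
  case/imsetP => z zS /set2_inj[[yz fyz]|[yz fyz]].
    by left; rewrite fyz yz.
  by right; rewrite fyz.
case: (edge_g x xS) => // -[fxS gfx]; exfalso.
(* Disagreement at [x] would propagate along the whole path from [x] to [r]. *)
suff walk k : iter k.+1 f x \in S :\ r /\ g (iter k.+1 f x) = iter k f x.
  move/forallP/(_ x)/iter_findex: rf; case: (findex _ _ _) => [/= xr|k fxr].
    by rewrite xr !inE eqxx in xS.
  by have [] := walk k; rewrite fxr !inE eqxx.
elim: k => // k [ykS gyk]; set y := iter k.+1 f x in ykS gyk *.
case: (edge_g y ykS) => // fy; rewrite gyk in fy.
have := rooted_acyclic (k := 1) (x := iter k f x) pf rf fy.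
move=> yr; have := ykS; rewrite /y /= yr parent_fun_root // !inE eqxx //.
Qed.

Definition avoiding (E : {set {set V}}) (x : V) : rel V :=
  [rel u v | [&& edge_rel E u v, u != x & v != x]].

Lemma avoiding_sym E x : symmetric (avoiding E x).
Proof. by move=> u v; rewrite /avoiding /= edge_rel_sym [(u != x) && _]andbC. Qed.

Lemma avoiding_sub (E : {set {set V}}) (x y u v : V) :
  connect (avoiding E x) u v -> connect (edge_rel (E :\ [set x; y])) u v.
Proof.
apply: connect_sub => a b /= /and3P[abE ax bx]; apply: connect1.
rewrite /edge_rel !inE; apply/andP; split=> //.
by apply: contraTneq (set21 x y) => <-; rewrite !inE negb_or !(eq_sym x) ax.
Qed.

Section TreeParent.
Variable E : {set {set V}}.
Hypothesis treeE : spanning_tree S adj E.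

Lemma tree_edge x y : [set x; y] \in E ->
  [/\ x \in S, y \in S, x != y & adj x y].
Proof.
move=> xyE; have /and3P[/forallP/(_ [set x; y]) + _ _] := treeE.
rewrite xyE => /existsP[u /andP[uS /existsP[v /andP[vS /and3P[uv auv]]]]].
by move=> /eqP/set2_inj[] [-> ->]; split=> //; rewrite 1?eq_sym // adj_sym.
Qed.

Lemma tree_connect x y : x \in S -> y \in S -> connect (edge_rel E) x y.
Proof.
move=> xS yS; have /and3P[_ /forallP/(_ x) + _] := treeE.
by rewrite xS => /forallP/(_ y); rewrite yS.
Qed.

Lemma tree_cut x y : [set x; y] \in E ->
  ~~ connect (edge_rel (E :\ [set x; y])) x y.
Proof.
move=> xyE; have [xS yS xy _] := tree_edge xyE.
have /and3P[_ _ /forallP/(_ x)] := treeE.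
by rewrite xS => /forallP/(_ y); rewrite yS xyE xy.
Qed.

(** The parent of [x] is the neighbour still connected to [r] once the vertex [x] is deleted. The
    default of [odflt] is not reached on [S :\ r]. *)
Definition tree_parent : {ffun V -> V} :=
  [ffun x => if x \in S :\ r then
     odflt r [pick y | ([set x; y] \in E) && connect (avoiding E x) y r] else r].

Lemma tree_parentP x : x \in S :\ r ->
  ([set x; tree_parent x] \in E) && connect (avoiding E x) (tree_parent x) r.
Proof.
move=> xS; rewrite ffunE xS; case: pickP => //= noy; exfalso.
move: xS; rewrite !inE => /andP[xr xS].
(* A path without repetition from [x] to [r] does not return to [x], so its second vertex can be
   picked. *)
have /connectP[p0 p0E] := tree_connect xS Sr; case/shortenP: p0E => p.
case: p => [|y p] /=; first by move=> _ _ _ rx; rewrite -rx eqxx in xr.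
case/andP=> xyE pE /andP[xyp _] _ rE.
have /negP := negbT (noy y); apply; rewrite [_ \in E]xyE /=.
apply/connectP; exists p => //.
elim: p y pE xyp {xyE rE} => //= z p IHp y /andP[yz zp].
rewrite !inE !negb_or => /and3P[xy xz xp].
by rewrite {1}/avoiding /= yz (eq_sym y) xy (eq_sym z) xz IHp // inE negb_or xz.
Qed.

Lemma tree_parent_fun : parent_fun tree_parent.
Proof.
apply/forallP => x; case: ifPn => [xS|/negPf xS]; last by rewrite ffunE xS.
by have /andP[/tree_edge[_ -> _ ->]] := tree_parentP xS.
Qed.

Definition descendants x : {set V} := [set u | ~~ connect (avoiding E x) u r].

Lemma self_descendant x : x != r -> x \in descendants x.
Proof.
rewrite inE; apply: contra => /connectP[[|y p] /=]; first by move=> _ ->.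
by rewrite {1}/avoiding /= eqxx andbF.
Qed.

(* In a tree, moving from a vertex to its parent strictly increases the set
   of descendants, so the parent function reaches the root. *)
Lemma descendants_proper x : x \in S :\ r -> tree_parent x != r ->
  descendants x \proper descendants (tree_parent x).
Proof.
move=> xS; have := tree_parentP xS; move: (tree_parent x) => y /andP[xyE yr_x] yr.
apply/properP; split; last first.
  by exists y; rewrite ?self_descendant // inE negbK.
apply/subsetP => u; rewrite !inE; apply: contra => ur_y.
have xr_y : ~~ connect (avoiding E y) x r.
  apply: contra (tree_cut xyE) => xr_y.
  apply: connect_trans (_ : connect _ r y).
    by rewrite setUC; apply: avoiding_sub xr_y.
  rewrite (sym_connect_sym (@edge_rel_sym _)); exact: avoiding_sub yr_x.
rewrite (sym_connect_sym (@avoiding_sym _ _)) in ur_y *.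
have {ur_y} := ur_y; rewrite (sym_connect_sym (@avoiding_sym _ _)) in xr_y.
pose D v := connect (avoiding E y) r v && connect (avoiding E x) r v.
suff: connect (avoiding E y) r u -> D r -> D u.
  move=> H ru; have := H ru; rewrite /D !connect0 => /(_ isT)/andP[_].
  by rewrite (sym_connect_sym (@avoiding_sym _ _)).
apply: connect_invariant => a b ab /andP[ra_y ra_x].
have rb_y : connect (avoiding E y) r b by apply: connect_trans ra_y (connect1 ab).
rewrite /D rb_y (connect_trans ra_x) // connect1 //=.
case/and3P: ab => abE _ _; rewrite /avoiding /= abE /=.
by apply/andP; split; apply: contraNneq xr_y => <-.
Qed.

Lemma tree_parent_rooted : rooted tree_parent.
Proof.
apply/forallP => x; have pf := tree_parent_fun.
have [m] := ubnP (#|V| - #|descendants x|); elim: m x => // m IHm x lem.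
have [xS|xS] := boolP (x \in S :\ r); last first.
  by rewrite -(parent_fun_out pf xS) fconnect1.
apply: connect_trans (fconnect1 _ _) _.
have [->|fxr] := eqVneq (tree_parent x) r; first exact: connect0.
apply: IHm; have ltD := proper_card (descendants_proper xS fxr).
rewrite ltnS in lem; apply: leq_trans lem; rewrite ltn_sub2l //.
exact: leq_trans ltD (max_card _).
Qed.

(** The parent edges already connect [S], so any further edge of [E] could be removed without
    disconnecting its endpoints, against acyclicity. *)
Lemma tree_parentK : parent_edges tree_parent = E.
Proof.
have sub : parent_edges tree_parent \subset E.
  by apply/subsetP => A /imsetP[x /tree_parentP/andP[+ _] ->].
apply/eqP; rewrite eqEsubset sub /=; apply/subsetP => A AE.
apply: contraT => notA.
have /and3P[/forallP/(_ A) + _ _] := treeE.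
rewrite AE => /existsP[x /andP[xS /existsP[y /andP[yS /and3P[_ _ /eqP eA]]]]].
have := AE; rewrite eA => /tree_cut/negP[].
have sub' : subrel (edge_rel (parent_edges tree_parent))
              (connect (edge_rel (E :\ [set x; y]))).
  move=> u v uv; apply: connect1; rewrite /edge_rel !inE (subsetP sub) // andbT.
  by apply: contraNneq notA; rewrite eA => <-.
have toroot z : z \in S -> connect (edge_rel (E :\ [set x; y])) z r.
  move=> zS; apply: connect_sub sub' _ _ _.
  exact: parent_edges_connect tree_parent_fun tree_parent_rooted zS.
apply: connect_trans (toroot x xS) _.
by rewrite (sym_connect_sym (@edge_rel_sym _)) toroot.
Qed.

End TreeParent.

Lemma num_spanning_trees_parent :
  num_spanning_trees S adj = #|[set f | parent_fun f && rooted f]|.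
Proof.
rewrite -(card_in_imset (f := parent_edges)); last first.
  by move=> f g; rewrite !inE; apply: parent_edges_inj.
apply: eq_card => E; rewrite !inE; apply/idP/imsetP => [treeE|[f + ->]].
  exists (tree_parent E); last by rewrite tree_parentK.
  by rewrite inE tree_parent_fun ?tree_parent_rooted.
by rewrite inE => /andP[]; apply: parent_edges_tree.
Qed.

End ParentFunctions.

(** * The matrix-tree theorem *)

Local Open Scope ring_scope.

Section FinMatrix.
Variable V : finType.

Definition fmx (A : V -> V -> rat) : 'M[rat]_#|V| :=
  \matrix_(i, j) A (enum_val i) (enum_val j).
Definition fcol (u : V -> rat) : 'cV[rat]_#|V| := \col_i u (enum_val i).
Definition frow (u : V -> rat) : 'rV[rat]_#|V| := \row_i u (enum_val i).

Lemma sum_enum_val (F : V -> rat) : \sum_(i < #|V|) F (enum_val i) = \sum_x F x.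
Proof. by rewrite -(big_enum_val (A := V)) /=. Qed.

Lemma prod_enum_val (F : V -> rat) : \prod_(i < #|V|) F (enum_val i) = \prod_x F x.
Proof. by rewrite -(big_enum_val (A := V)) /=. Qed.

Lemma fmx_mul A B : fmx A *m fmx B = fmx (fun x y => \sum_z A x z * B z y).
Proof.
apply/matrixP => i j; rewrite !mxE -sum_enum_val.
by apply: eq_bigr => k _; rewrite !mxE.
Qed.

Lemma frow_col u v : frow u *m fcol v = (\sum_x u x * v x)%:M.
Proof.
apply/matrixP => i j; rewrite !ord1 !mxE -sum_enum_val mulr1n.
by apply: eq_bigr => k _; rewrite !mxE.
Qed.

Lemma fmx1 : fmx (fun x y => (x == y)%:R) = 1%:M.
Proof. by apply/matrixP => i j; rewrite !mxE (inj_eq enum_val_inj). Qed.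

Lemma eq_fmx A B : (forall x y, A x y = B x y) -> fmx A = fmx B.
Proof. by move=> eqAB; apply/matrixP => i j; rewrite !mxE. Qed.

(** Multilinearity in the rows: choosing one summand in every row amounts to choosing a function
    [f]. *)
Lemma det_fmx_sum (w : V -> V -> rat) (B : V -> V -> V -> rat) :
  \det (fmx (fun x z => \sum_y w x y * B x y z)) =
  \sum_(f : {ffun V -> V}) (\prod_x w x (f x)) * \det (fmx (fun x => B x (f x))).
Proof.
rewrite /determinant.
under [RHS]eq_bigr do rewrite mulr_sumr.
rewrite exchange_big /=; apply: eq_bigr => s _.
pose t x := enum_val (s (enum_rank x)).
transitivity ((-1) ^+ s * \prod_x \sum_y w x y * B x y (t x)).
  congr (_ * _); rewrite -prod_enum_val; apply: eq_bigr => i _.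
  by rewrite mxE /t enum_valK.
rewrite bigA_distr_bigA mulr_sumr; apply: eq_bigr => f _.
rewrite big_split /= mulrCA; congr (_ * (_ * _)).
rewrite -prod_enum_val; apply: eq_bigr => i _.
by rewrite mxE /t enum_valK.
Qed.

End FinMatrix.

(** The matrix determinant lemma: conjugation by a unitriangular block matrix moves the perturbation
    from the upper left block to the 1 by 1 lower right block. *)
Lemma det_add_rank1 (n : nat) (u : 'cV[rat]_n) (v : 'rV[rat]_n) :
  \det (1%:M + u *m v) = 1 + (v *m u) ord0 ord0.
Proof.
have e : block_mx 1%:M 0 v 1%:M *m block_mx (1%:M + u *m v) u 0 1%:M
   *m block_mx 1%:M 0 (- v) 1%:M = block_mx 1%:M u 0 (1%:M + v *m u).
  rewrite !mulmx_block !mul1mx !mulmx1 !mul0mx !mulmx0 !addr0 !add0r.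
  rewrite [v *m u + _]addrC; congr block_mx; first by rewrite mulmxN addrK.
  by rewrite mulmxN mulmxDr mulmxDl mul1mx mulmx1 mulmxA subrr.
have := congr1 determinant e; rewrite !det_mulmx !det_ublock !det_lblock !det1.
by rewrite !mul1r !mulr1 det_mx11 !mxE eqxx => ->.
Qed.

Section MatrixTree.
Variables (V : finType) (S : {set V}) (adj : rel V) (r : V).
Hypotheses (Sr : r \in S) (adj_sym : symmetric adj) (adj_irr : irreflexive adj).

(** Row [x] of the Laplacian of the directed graph of [f], with the off-diagonal entry in the column
    of the root erased. For [f r = r] the row of the root is a unit vector, so the full determinant
    equals the minor at [r]. *)
Definition lap_row (f : V -> V) (x z : V) : rat :=
  (x == z)%:R - ((f x == z) && (z != r))%:R.

Lemma det_rooted (f : {ffun V -> V}) : parent_fun S adj r f -> rooted r f ->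
  \det (fmx (lap_row f)) = 1.
Proof.
move=> pf rf; rewrite /determinant (bigD1 1%g) //= odd_perm1 mul1r.
rewrite [X in _ + X]big1 ?addr0 => [|s s1].
  apply: big1 => i _; rewrite mxE perm1 /lap_row eqxx.
  have [fx|_] /= := eqVneq (f _) _; last by rewrite subr0.
  by rewrite (rooted_acyclic (k := 0) pf rf fx) eqxx subr0.
have [i si] : exists i, s i != i.
  apply/existsP; rewrite -negb_forall; apply: contra s1 => /forallP H.
  by apply/eqP/permP => i; rewrite perm1; apply/eqP.
(* A permutation contributing to the expansion follows [f] on the points it
   moves, hence would produce a cycle of [f]. *)
apply/eqP; rewrite mulf_eq0 signr_eq0 /=; apply: contraT => /prodf_neq0 nz.
have step j : s j != j -> f (enum_val j) = enum_val (s j) /\ enum_val (s j) != r.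
  move=> sj; have := nz j isT; rewrite mxE /lap_row (inj_eq enum_val_inj).
  rewrite [j == _]eq_sym (negPf sj) sub0r oppr_eq0 pnatr_eq0 eqb0 negbK.
  by case/andP=> /eqP.
have walk k : s ((s ^+ k)%g i) != (s ^+ k)%g i /\
              iter k f (enum_val i) = enum_val ((s ^+ k)%g i).
  elim: k => [|k [IH1 IH2]]; first by rewrite expg0 perm1.
  rewrite expgSr permM (inj_eq perm_inj) IH1; split=> //=.
  by rewrite IH2; case: (step _ IH1).
move/forallP/(_ (enum_val i))/iter_findex: rf; move: (findex _ _ _) => k.
have [sk ->] := walk k; have [fk nr] := step _ sk => kr.
by rewrite -fk kr (parent_fun_root pf) eqxx in nr.
Qed.

(** The indicator of the vertices that never reach [r] is constant along [f] and vanishes at [r],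
    hence is a nonzero kernel vector. *)
Lemma det_not_rooted (f : {ffun V -> V}) : parent_fun S adj r f -> ~~ rooted r f ->
  \det (fmx (lap_row f)) = 0.
Proof.
move=> pf /forallPn[x xr]; apply/eqP; rewrite -det_tr; apply/det0P.
exists (frow (fun z => (~~ fconnect f z r)%:R)).
  apply/eqP => /matrixP/(_ ord0 (enum_rank x)); rewrite !mxE enum_rankK xr.
  by move/eqP; rewrite oner_eq0.
apply/matrixP => i j; rewrite !mxE.
under eq_bigr do rewrite !mxE.
rewrite (sum_enum_val (fun z => (~~ fconnect f z r)%:R * lap_row f (enum_val j) z)).
move: (enum_val j) => y; rewrite /lap_row.
under eq_bigr do rewrite mulrBr.
rewrite sumrB (bigD1 y) //= eqxx mulr1 big1 ?addr0; last first.
  by move=> z zy; rewrite eq_sym (negPf zy) mulr0.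
rewrite (bigD1 (f y)) //= eqxx big1 ?addr0; last first.
  by move=> z zy; rewrite eq_sym (negPf zy) mulr0.
have [yr|yr] := eqVneq y r.
  by rewrite yr (parent_fun_root pf) connect0 mul0r subrr.
have -> : fconnect f y r = fconnect f (f y) r.
  apply/idP/idP; last by apply: connect_trans; apply: fconnect1.
  move=> /iter_findex; case: (findex _ _ _) => [/= yr'|k].
    by rewrite yr' eqxx in yr.
  by rewrite iterSr => <-; apply: fconnect_iter.
have [->|_] := eqVneq (f y) r; first by rewrite connect0 mul0r subrr.
by rewrite mulr1 subrr.
Qed.

(** The reduced Laplacian minus the identity, extended by zero. Then [1%:M + fmx lap] has the size
    of the whole type for every [S], and matrices of different vertex sets can be added and
    multiplied. *)
Definition lap (x y : V) : rat :=
  if (x \in S :\ r) && (y \in S :\ r)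
  then (x == y)%:R * (#|[set z in S | adj x z]|%:R - 1) - (adj x y)%:R else 0.

(** Each row of the reduced Laplacian is a sum of rows [lap_row (fun=> y)] over the neighbours [y].
    Multilinearity then gives a sum over parent functions, in which the rooted ones count 1 and the
    others 0. *)
Theorem matrix_tree : (num_spanning_trees S adj)%:R = \det (1%:M + fmx lap).
Proof.
rewrite (num_spanning_trees_parent Sr adj_sym adj_irr).
pose w x y : rat :=
  (if x \in S :\ r then (y \in S) && adj x y else y == r)%:R.
have -> : 1%:M + fmx lap =
  fmx (fun x z => \sum_y w x y * lap_row (fun=> y) x z).
  rewrite -fmx1; apply/matrixP => i j; rewrite !mxE.
  move: (enum_val i) (enum_val j) => x z; rewrite /lap /w /lap_row.
  case: (boolP (x \in S :\ r)) => xS /=; last first.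
    rewrite addr0 (bigD1 r) //= eqxx mul1r big1 ?addr0; last first.
      by move=> y /negPf->; rewrite mul0r.
    by rewrite [r == z]eq_sym andbN subr0.
  under eq_bigr do rewrite mulrBr.
  rewrite sumrB -mulr_suml -natr_sum.
  have -> : (\sum_y ((y \in S) && adj x y) = #|[set z in S | adj x z]|)%N.
    rewrite -sum1_card big_mkcond /= [RHS]big_mkcond /=; apply: eq_bigr => y _.
    by rewrite !inE; case: andb.
  rewrite (bigD1 z) //= eqxx /= big1 ?addr0; last first.
    by move=> y /negPf->; rewrite mulr0.
  have /setD1P[xr xS'] := xS; rewrite !inE.
  have [->|zr] /= := eqVneq z r.
    by rewrite (negPf xr) !mulr0 oppr0.
  rewrite mulr1; have [zS|zS] /= := boolP (z \in S).
    by rewrite mulrBr mulr1 [_%:R * #|_|%:R]mulrC addrA [_%:R + _]addrC subrK.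
  have -> : (x == z) = false by apply: contraNF zS => /eqP <-.
  by rewrite !mulr0 oppr0.
rewrite det_fmx_sum -sum1_card natr_sum big_mkcond /=; apply: eq_bigr => f _.
rewrite inE; have [pf|npf] /= := boolP (parent_fun S adj r f).
  have -> : \prod_x w x (f x) = 1.
    apply: big1 => x _; rewrite /w; move/forallP/(_ x): pf.
    by case: ifP => _ ->.
  rewrite mul1r; have -> : fmx (fun x => lap_row (fun=> f x) x) = fmx (lap_row f) by [].
  by case: ifPn => rf; rewrite ?(det_rooted pf rf) ?(det_not_rooted pf rf).
case/forallPn: npf => x npf; rewrite (bigD1 x) //= /w.
by case: ifP npf => _ /negPf ->; rewrite !mul0r.
Qed.

End MatrixTree.

(** * Spanning trees of commuting graphs *)

Lemma fmx_mul0 (V : finType) (A B : V -> V -> rat) :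
  (forall x z y, A x z != 0 -> B z y = 0) -> fmx A *m fmx B = 0.
Proof.
move=> AB; rewrite fmx_mul; apply/matrixP => i j; rewrite !mxE big1 // => z _.
by have [->|/AB->] := eqVneq (A (enum_val i) z) 0; rewrite ?mul0r ?mulr0.
Qed.

Lemma det_add_orthogonal (n : nat) (I : eqType) (s : seq I) (N : I -> 'M[rat]_n) :
  uniq s -> {in s &, forall a b, a != b -> N a *m N b = 0} ->
  \det (1%:M + \sum_(a <- s) N a) = \prod_(a <- s) \det (1%:M + N a).
Proof.
elim: s => [|a s IHs] /=; first by rewrite !big_nil addr0 det1.
case/andP=> as_ us Ns; rewrite !big_cons -IHs //; last first.
  by move=> b c bs cs; apply: Ns; rewrite inE ?bs ?cs orbT.
have Na0 : N a *m \sum_(b <- s) N b = 0.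
  rewrite mulmx_sumr big_seq big1 // => b bs.
  apply: Ns; rewrite ?inE ?eqxx ?bs ?orbT //; by apply: contraNneq as_ => ->.
by rewrite -det_mulmx mulmxDl mul1mx mulmxDr mulmx1 Na0 addr0 -addrA [_ + N a]addrC.
Qed.

Section FinMatrixTheory.
Variable V : finType.
Implicit Types A B : V -> V -> rat.

Lemma fmxD A B : fmx A + fmx B = fmx (fun x y => A x y + B x y).
Proof. by apply/matrixP => i j; rewrite !mxE. Qed.

Lemma fcol_row (u v : V -> rat) : fcol u *m frow v = fmx (fun x y => u x * v y).
Proof. by apply/matrixP => i j; rewrite !mxE big_ord1 !mxE. Qed.

Lemma fmx_diag_mul (d : V -> rat) A :
  fmx (fun x y => (x == y)%:R * d x) *m fmx A = fmx (fun x y => d x * A x y).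
Proof.
rewrite fmx_mul; apply: eq_fmx => x y; rewrite (bigD1 x) //= eqxx mul1r.
by rewrite big1 ?addr0 // => z; rewrite eq_sym => /negPf->; rewrite !mul0r.
Qed.

Lemma det_fmx_diag (d : V -> rat) :
  \det (fmx (fun x y => (x == y)%:R * d x)) = \prod_x d x.
Proof.
transitivity (\det (diag_mx (frow d))).
  congr (\det _); apply/matrixP => i j.
  rewrite !mxE (inj_eq enum_val_inj) mulrb.
  by case: eqP => [->|]; rewrite ?mul1r ?mul0r.
by rewrite det_diag -prod_enum_val; apply: eq_bigr => i _; rewrite mxE.
Qed.

Lemma sum_indicator (A : {set V}) : \sum_x (x \in A)%:R = #|A|%:R :> rat.
Proof. by rewrite -natr_sum -sum1_card [in RHS]big_mkcond. Qed.

(** On [C] the matrix is [c] times the identity plus [e] times the all-ones matrix: a diagonal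
    matrix times a rank-one perturbation of the identity. *)
Lemma det_clique (C : {set V}) (c e : rat) : c != 0 ->
  \det (1%:M + fmx (fun x y => if (x \in C) && (y \in C)
                               then (x == y)%:R * (c - 1) + e else 0)) =
  c ^+ #|C| * (1 + #|C|%:R * e / c).
Proof.
move=> c0; pose d x : rat := if x \in C then c else 1.
pose u x : rat := (x \in C)%:R * (e / c).
pose v x : rat := (x \in C)%:R.
transitivity (\det (fmx (fun x y => (x == y)%:R * d x) *m (1%:M + fcol u *m frow v))).
  congr (\det _); rewrite mulmxDr mulmx1 fcol_row fmx_diag_mul -fmx1 !fmxD.
  apply: eq_fmx => x y; rewrite /d /u /v.
  have [xC|xC] /= := boolP (x \in C); last first.
    by rewrite !mul0r mulr0 mulr1.
  have [yC|yC] /= := boolP (y \in C).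
    by rewrite mul1r mulr1 mulrCA divff // mulr1 addrA mulrBr mulr1 [_%:R + _]addrC subrK.
  rewrite mulr0 mulr0 !addr0.
  by case: eqP yC => [<-|_]; rewrite ?xC ?mul0r.
rewrite det_mulmx det_fmx_diag det_add_rank1 frow_col !mxE eqxx mulr1n; congr (_ * (1 + _)).
  by rewrite /d -big_mkcond /= prodr_const.
under eq_bigr do rewrite /u /v mulrA -natrM mulnb andbb.
by rewrite -mulr_suml sum_indicator mulrA.
Qed.

End FinMatrixTheory.

Section Commuting.
Variable gT : finGroupType.
Implicit Types (A S : {set gT}) (G H : {group gT}) (x y : gT).

Local Notation adj := (@commuting_adj gT).
Local Notation clap := (fun S => lap S adj 1%g).

Lemma commuting_adj_sym : symmetric adj.
Proof. by move=> x y; rewrite /commuting_adj eq_sym [(_ * _ == _)%g]eq_sym. Qed.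

Lemma commuting_adj_irr : irreflexive adj.
Proof. by move=> x; rewrite /commuting_adj eqxx. Qed.

Lemma kappa_det S : 1%g \in S -> (kappa_C S)%:R = \det (1%:M + fmx (clap S)).
Proof.
by move=> S1; rewrite -matrix_tree //; [exact: commuting_adj_sym | exact: commuting_adj_irr].
Qed.

(** All neighbours of a nontrivial vertex lie in the one member of [P] containing it, so its row,
    degree included, is that of the member. With the row and column of 1 removed, distinct members
    have disjoint supports and their matrices annihilate each other. *)
Lemma kappa_block (G : {group gT}) (P : {set {set gT}}) :
  {in P, forall A, (1%g \in A) && (A \subset G)} ->
  {in P, forall A, {in A^#%g, forall x, {in G, forall y, commute x y -> y \in A}}} ->
  {in P &, forall A B : {set gT}, forall x, x \in A^#%g -> x \in B -> A = B} ->
  {in G^#%g, forall x, exists2 A, A \in P & x \in A} ->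
  kappa_C G = (\prod_(A in P) kappa_C A)%N.
Proof.
move=> P1 Pc Ptriv Pcov; apply/eqP; rewrite -(eqr_nat rat) natr_prod.
rewrite kappa_det ?group1 //.
have lap0 A x y : (clap A x y) != 0 -> (x \in A^#%g) && (y \in A^#%g).
  by rewrite /lap; case: ifP => //; rewrite eqxx.
have -> : fmx (clap G) = \sum_(A <- enum P) fmx (clap A).
  rewrite big_enum; apply/matrixP => i j; rewrite summxE mxE.
  under eq_bigr do rewrite mxE.
  move: (enum_val i) (enum_val j) => x y.
  have [xG|xG] := boolP (x \in G^#%g); last first.
    rewrite [LHS]/lap (negPf xG) big1 // => A /P1/andP[_ AG].
    rewrite /lap; case: ifP => // /andP[xA _].
    by rewrite (subsetP (setSD _ AG) _ xA) in xG.
  have [A AP xA] := Pcov x xG; have xA' : x \in A^#%g.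
    by move: xG; rewrite !inE xA => /andP[->].
  have /andP[_ AG] := P1 A AP.
  rewrite (bigD1 A) //= [X in _ + X]big1 ?addr0 => [|B /andP[BP BA]]; last first.
    apply/eqP; apply: contraNT BA => /lap0/andP[xB _].
    by apply/eqP; apply: Ptriv BP AP x xB xA.
  rewrite /lap xG xA' /=.
  have cA z : z \in G -> adj x z -> z \in A.
    by move=> zG /andP[_ /eqP xz]; apply: Pc AP x xA' z zG xz.
  have -> : [set z in G | adj x z] = [set z in A | adj x z].
    apply/setP => z; rewrite !inE; have [zA|zA] := boolP (z \in A).
      by rewrite (subsetP AG).
    by apply: contraNF zA => /andP[]; apply: cA.
  have [yA|yA] := boolP (y \in A^#%g).
    by rewrite (subsetP (setSD _ AG) _ yA).
  case: ifP => // yG; case/setD1P: yG => y1 yG.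
  have yA' : y \notin A by apply: contra yA => yA; rewrite !inE y1.
  have -> : (x == y) = false by apply: contraNF yA' => /eqP <-.
  by rewrite (contraNF (cA y yG) yA') mul0r subr0.
rewrite det_add_orthogonal ?enum_uniq //; last first.
  move=> A B; rewrite !mem_enum => AP BP AB; apply: fmx_mul0 => x z y.
  case/lap0/andP=> _ zA; apply/eqP; apply: contraNT AB => /lap0/andP[zB _].
  by case/setD1P: zB => _ zB; apply/eqP; apply: (Ptriv A B AP BP z zA zB).
rewrite big_enum; apply/eqP; apply: eq_bigr => A /P1/andP[A1 _].
by rewrite kappa_det.
Qed.

Lemma kappa_abelian G : abelian G -> kappa_C G = (#|G| ^ (#|G| - 2))%N.
Proof.
move=> abG; apply/eqP; rewrite -(eqr_nat rat) kappa_det ?group1 //.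
have G0 : (#|G|%:R : rat) != 0 by rewrite pnatr_eq0 -lt0n cardG_gt0.
rewrite -(@eq_fmx _ (fun x y => if (x \in G^#%g) && (y \in G^#%g)
                    then (x == y)%:R * (#|G|%:R - 1) + -1 else 0)); last first.
  move=> x y; rewrite /lap; case: ifP => // /andP[/setD1P[_ xG] /setD1P[_ yG]].
  have adjE z : z \in G -> adj x z = (x != z).
    by move=> zG; rewrite /commuting_adj (centsP abG _ xG _ zG) eqxx andbT.
  have -> : [set z in G | adj x z] = G :\ x.
    apply/setP => z; rewrite !inE andbC; have [zG|] := boolP (z \in G); last by rewrite !andbF.
    by rewrite adjE // eq_sym.
  rewrite adjE // (cardsD1 x G) xG natrD [1 + _]addrC addrK.
  by case: eqVneq => _; rewrite ?mul1r ?mul0r ?subr0 // addrK.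
rewrite det_clique // mulrN1 mulNr.
have -> : #|G^#%g| = #|G|.-1 by rewrite cardsDS ?sub1G // cards1 subn1.
case: #|G| (cardG_gt0 G) G0 => // m _ G0 /=.
have -> : 1 - m%:R / m.+1%:R = m.+1%:R^-1 :> rat.
  by rewrite -{1}(divff G0) -mulrBl -natrB // subSnn mul1r.
(* For the trivial group the exponent [#|G| - 2] is truncated to 0. *)
case: m G0 => [|m] G0; first by rewrite expr0 mul1r invr1.
by rewrite exprSr mulfK // natrX !subSS subn0.
Qed.

End Commuting.

(** The left side collects [q - 1] cliques of size [q], each contributing [(2q)^q / 2], and one of
    size [q - 1] contributing [q^(2q-2) / q]. *)
Lemma kappa_centered_arith (q : nat) : (0 < q)%N ->
  ((q + q)%:R ^+ q * (1 + q%:R * -1 / (q + q)%:R)) ^+ q.-1 *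
  ((q * q)%:R ^+ q.-1 * (1 + q.-1%:R * - q%:R / (q * q)%:R)) =
  (2 ^ ((q - 1) ^ 2) * q ^ (q ^ 2 + q - 3))%:R :> rat.
Proof.
case: q => // m _; set Q := m.+1%:R : rat; rewrite /=.
have half (x : rat) : x + x != 0 -> 1 + x * -1 / (x + x) = 2^-1.
  by move=> xx; field.
have inv (x : rat) : x != 0 -> 1 + (x - 1) * - x / (x * x) = x^-1.
  by move=> x0; field.
have pow (x : rat) k : (x + x) ^+ k.+1 / 2 = 2 ^+ k * x ^+ k.+1.
  by rewrite -mulr2n -[x *+ 2]mulr_natl exprMn exprS; field.
have Q0 : Q != 0 by rewrite pnatr_eq0.
rewrite natrD natrM -/Q half -?natrD ?pnatr_eq0 // natrD -/Q.
have -> : m%:R = Q - 1 :> rat by rewrite /Q -addn1 natrD addrK.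
rewrite inv // pow; clear half inv pow.
case: m @Q Q0 => [|m] Q Q0; first by rewrite !expr0 invr1 !mulr1.
have -> : ((m.+2 ^ 2 + m.+2 - 3) = (m.+2 * m.+1) + (m + m.+1))%N.
  by rewrite -mulnn !mulSn; lia.
rewrite subn1 /= natrM !natrX -/Q exprMn -!exprM -!mulrA mulnn; congr (_ * _).
rewrite exprD; congr (_ * _); rewrite -expr2 -exprM mul2n -addnn addSn.
by rewrite exprS mulrC mulKf.
Qed.

(** * Groups where commutation is read off one coordinate *)

Section CenteredCommuting.
Variables (gT : finGroupType) (S : {set gT}) (K : finType) (k0 : K) (phi : gT -> K).
Variable q : nat.
Hypotheses (S1 : 1%g \in S) (phi1 : phi 1%g = k0) (cardK : #|K| = q).
Hypothesis card_fiber : forall k, #|[set x in S | phi x == k]| = q.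
Hypothesis commute_phi : {in S &, forall x y,
  (x * y == y * x)%g = [|| phi x == k0, phi y == k0 | phi x == phi y]}.

Let Z : {set gT} := [set x in S^#%g | phi x == k0].
Let X : {set gT} := [set x in S | phi x != k0].
Let fiber k : {set gT} := [set x in S | phi x == k].
Let q_gt0 : (0 < q)%N. Proof. by rewrite -cardK; apply/card_gt0P; exists k0. Qed.
Let qnz : (q%:R : rat) != 0. Proof. by rewrite pnatr_eq0 -lt0n. Qed.

Let card_S : #|S| = (q * q)%N.
Proof.
rewrite -sum1_card (partition_big phi xpredT) //=.
rewrite -[in RHS]cardK -sum_nat_const; apply: eq_bigr => k _.
by rewrite cardK -(card_fiber k) -sum1_card; apply: eq_bigl => x; rewrite inE.
Qed.

Let card_Z : #|Z| = q.-1.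
Proof.
rewrite -(card_fiber k0) (cardsD1 1%g (fiber k0)) !inE S1 phi1 eqxx /=.
by apply: eq_card => x; rewrite !inE andbA.
Qed.

Let card_X : #|X| = (q * q - q)%N.
Proof.
rewrite -card_S -(card_fiber k0) -cardsDS; last by apply/subsetP => x /[!inE] /andP[].
by apply: eq_card => x; rewrite !inE; case: (x \in S) => //=; rewrite andbT.
Qed.

Let disjZX x : x \in Z -> x \in X = false.
Proof. by rewrite !inE => /andP[_ ->]; rewrite andbF. Qed.

Let SZX x : (x \in S :\ 1%g) = (x \in Z) || (x \in X).
Proof.
rewrite !inE; case: (eqVneq (phi x) k0) => [|phix]; rewrite ?andbT ?andbF ?orbF //=.
by case: (eqVneq x 1%g) phix => [->|//]; rewrite phi1 eqxx.
Qed.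

Local Notation L := (fun x y => (x == y)%:R + lap S (@commuting_adj gT) 1%g x y).

Let com x y := [|| phi x == k0, phi y == k0 | phi x == phi y].
Let cent x : nat := if x \in Z then (q * q)%N else (q + q)%N.

(** Both [cent] and [com] count [x] among its own neighbours, and the two extra units cancel on the
    diagonal. *)
Let lapE x y : L x y =
  (x == y)%:R + if (x \in S :\ 1%g) && (y \in S :\ 1%g)
                then (x == y)%:R * ((cent x)%:R - 1) - (com x y)%:R else 0.
Proof.
rewrite /lap; case: ifP => // /andP[xS' yS']; congr (_ + _).
have /setD1P[x1 xS] := xS'; have /setD1P[y1 yS] := yS'.
have comE z : z \in S -> commuting_adj x z = (x != z) && com x z.
  by move=> zS; rewrite /commuting_adj commute_phi.
rewrite comE //; have -> : cent x = #|[set z in S | commuting_adj x z]|.+1.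
  have -> : [set z in S | commuting_adj x z] = [set z in S | com x z] :\ x.
    apply/setP => z; rewrite !inE; case: (boolP (z \in S)) => zS /=; last by rewrite andbF.
    by rewrite comE // eq_sym.
  have -> : #|[set z in S | com x z] :\ x|.+1 = #|[set z in S | com x z]|.
    by rewrite [RHS](cardsD1 x) inE xS /com eqxx !orbT.
  rewrite /cent !inE x1 xS /= /com; case: (eqVneq (phi x) k0) => phix /=.
    by rewrite -card_S; apply: eq_card => z; rewrite inE andbT.
  rewrite -{1}(card_fiber k0) -(card_fiber (phi x)) -cardsUI.
  rewrite [X in (_ + X)%N](_ : _ = 0%N) ?addn0.
    apply: eq_card => z; rewrite !inE -andb_orr; congr (_ && (_ || _)).
    exact: eq_sym.
  apply/eqP; rewrite cards_eq0; apply/eqP/setP => z; rewrite !inE.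
  by case: (eqVneq (phi z) k0) => [->|]; rewrite ?andbF // [k0 == _]eq_sym (negPf phix) !andbF.
rewrite -[_.+1]addn1 natrD addrK.
case: eqVneq => [<-|_] /=; last by rewrite !mul0r.
by rewrite !mul1r subr0 /com eqxx !orbT.
Qed.

(** [A] is the block from [Z] to [X] and [N k] the block of a fibre. [B] is the block of [Z] after
    the column operation below: the [q^2 - q] columns of [X], scaled by [q^-1], lower the entries -1
    to [-q]. *)
Let A x y : rat := - ((x \in Z)%:R * (y \in X)%:R).
Let B x y : rat := if (x \in Z) && (y \in Z)
  then (x == y)%:R * ((q * q)%:R - 1) + - q%:R else 0.
Let N k x y : rat := if (x \in fiber k) && (y \in fiber k)
  then (x == y)%:R * ((q + q)%:R - 1) + -1 else 0.

Let sum_N x y : \sum_(k | k != k0) N k x y =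
  if [&& x \in X, y \in X & phi x == phi y]
  then (x == y)%:R * ((q + q)%:R - 1) - 1 else 0.
Proof.
have [xX|xX] /= := boolP (x \in X); last first.
  apply: big1 => k kk; rewrite /N; case: ifP => // /andP[]; rewrite !inE => /andP[xS /eqP xk].
  by rewrite inE xS xk kk in xX.
have /setIdP[xS phix] := xX.
rewrite (bigD1 (phi x)) //= big1 ?addr0 => [|k /andP[_ kx]].
  rewrite /N !inE xS eqxx /=; case: (boolP (y \in S)) => //= yS.
  rewrite [phi x == _]eq_sym; case: eqVneq => [->|]; rewrite ?andbF // phix //.
by rewrite /N !inE [phi x == k]eq_sym (negPf kx) andbF.
Qed.

(* Adding [q^-1] times the sum of the columns of [X] to each column of [Z]
   makes the Laplacian block triangular, [X] acting as a disjoint union of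
   cliques. *)
Let factor :
  fmx L *m (1%:M + fcol (fun x => q%:R^-1 * (x \in X)%:R) *m frow (fun x => (x \in Z)%:R)) =
  (1%:M + \sum_(k <- enum [set k | k != k0]) fmx (N k)) *m ((1%:M + fmx A) *m (1%:M + fmx B)).
Proof.
have -> : \sum_(k <- enum [set k | k != k0]) fmx (N k) =
          fmx (fun x y => \sum_(k | k != k0) N k x y).
  rewrite big_enum; apply/matrixP => i j; rewrite summxE mxE.
  by apply: eq_big => [k|k _]; rewrite ?inE // mxE.
have NX x y : \sum_(k | k != k0) N k x y != 0 -> (y \in X).
  by rewrite sum_N; case: ifP; rewrite ?eqxx // => /and3P[].
have A0 x y : A x y != 0 -> y \in X.
  by rewrite /A; case: (y \in X); rewrite // mulr0 oppr0 eqxx.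
have ZN x : x \in X -> x \in Z = false.
  by move=> xX; apply/negP => /disjZX; rewrite xX.
have AZ x y : x \in X -> A x y = 0 by move/ZN => xZ; rewrite /A xZ mul0r oppr0.
have BZ x y : x \in X -> B x y = 0 by move/ZN => xZ; rewrite /B xZ.
have AB : fmx A *m fmx B = 0 by apply: fmx_mul0 => x z y /A0/BZ.
set M := fmx (fun x y => \sum_(k | k != k0) N k x y).
have MA : M *m fmx A = 0 by apply: fmx_mul0 => x z y /NX/AZ.
have MB : M *m fmx B = 0 by apply: fmx_mul0 => x z y /NX/BZ.
have -> : (1%:M + fmx A) *m (1%:M + fmx B) = 1%:M + fmx A + fmx B.
  by rewrite mulmxDr mulmx1 mulmxDl mul1mx AB addr0.
rewrite [RHS]mulmxDl mul1mx ![M *m _]mulmxDr MA MB mulmx1 !addr0.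
rewrite fcol_row mulmxDr mulmx1 fmx_mul -fmx1 !fmxD.
apply: eq_fmx => x y.
under eq_bigr do rewrite !mulrA.
rewrite -!mulr_suml.
have LX z : z \in X ->
    L x z = if x \in X then (x == z)%:R * (q + q)%:R - (phi x == phi z)%:R
            else - (x \in Z)%:R.
  move=> zX; rewrite lapE SZX [z \in S :\ _]SZX zX orbT andbT /cent /com.
  have /setIdP[_ /negPf phiz] := zX; rewrite phiz /=.
  case: (boolP (x \in X)) => xX.
    rewrite ZN //=; have /setIdP[_ /negPf ->] := xX; ring.
  have -> : (x == z) = false by apply: contraNF xX => /eqP->.
  rewrite orbF; case: (boolP (x \in Z)) => [|_]; last by rewrite addr0 oppr0.
  by rewrite inE => /andP[_ ->] /=; ring.
have rowsum : \sum_z L x z * q%:R^-1 * (z \in X)%:R =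
  (x \in X)%:R - (q%:R - 1) * (x \in Z)%:R.
  transitivity (\sum_(z in X) L x z * q%:R^-1).
    by rewrite [RHS]big_mkcond; apply: eq_bigr => z _; case: ifP; rewrite ?mulr1 ?mulr0.
  rewrite -mulr_suml (eq_bigr _ LX).
  case: (boolP (x \in X)) => xX.
    rewrite sumrB ZN // mulr0 subr0.
    have -> : \sum_(z in X) (x == z)%:R * (q + q)%:R = (q + q)%:R :> rat.
      rewrite (bigD1 x) //= eqxx mul1r big1 ?addr0 // => z /andP[_].
      by rewrite eq_sym => /negPf->; rewrite mul0r.
    have -> : \sum_(z in X) (phi x == phi z)%:R = q%:R :> rat.
      rewrite -natr_sum -(card_fiber (phi x)) -sum1_card [in RHS]big_mkcond.
      rewrite [in LHS]big_mkcond /=; congr (_%:R); apply: eq_bigr => z _.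
      rewrite !inE [phi x == _]eq_sym; case: (z \in S) => //=.
      case: (eqVneq (phi z) (phi x)) => [->|_]; last by case: ifP.
      by case/setIdP: xX => _ ->.
    by rewrite natrD addrK divff.
  rewrite sumr_const card_X -[_ *+ (_ - _)]mulr_natr natrB ?leq_pmulr // natrM /=.
  by field.
rewrite rowsum lapE [RHS]addrC sum_N /A /B SZX [y \in S :\ _]SZX /cent /com.
case: (boolP (x \in Z)) => [xZ|xZ].
  rewrite (disjZX xZ) /=; have /setIdP[_ ->] := xZ.
  case: (boolP (y \in Z)) => [yZ|yZ] /=.
    by rewrite (disjZX yZ) natrM /=; ring.
  case: (boolP (y \in X)) => yX; last by rewrite /=; ring.
  have -> : (x == y) = false by apply: contraNF yZ => /eqP <-.
  by rewrite /=; ring.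
case: (boolP (x \in X)) => [xX|xX] /=; last by rewrite /=; ring.
have /setIdP[_ /negPf ->] := xX.
case: (boolP (y \in Z)) => [yZ|yZ] /=.
  have -> : (x == y) = false by apply: contraNF xZ => /eqP ->.
  have /setIdP[_ ->] := yZ; by rewrite (disjZX yZ) /=; ring.
case: (boolP (y \in X)) => yX /=; last by ring.
have /setIdP[_ /negPf ->] := yX.
case: (eqVneq (phi x) (phi y)) => [_|nxy] /=; first by ring.
have -> : (x == y) = false by apply: contraNF nxy => /eqP ->.
by rewrite /=; ring.
Qed.

Lemma kappa_centered :
  kappa_C S = (2 ^ ((q - 1) ^ 2) * q ^ (q ^ 2 + q - 3))%N.
Proof.
apply/eqP; rewrite -(eqr_nat rat) kappa_det // -fmx1 fmxD; apply/eqP.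
have := congr1 determinant factor.
rewrite !det_mulmx !det_add_rank1 frow_col !mxE big1 ?mulr0n ?addr0 ?mulr1; last first.
  move=> x _; case: (boolP (x \in Z)) => xZ; last by rewrite mul0r.
  by rewrite disjZX // !mulr0.
have -> : \det (1%:M + fmx A) = 1.
  have -> : fmx A = fcol (fun x => - (x \in Z)%:R) *m frow (fun x => (x \in X)%:R).
    by rewrite fcol_row; apply: eq_fmx => x y; rewrite /A mulNr.
  rewrite det_add_rank1 frow_col !mxE big1 ?mulr0n ?addr0 // => x _.
  case: (boolP (x \in Z)) => xZ; last by rewrite oppr0 mulr0.
  by rewrite disjZX // mul0r.
have qq0 : (q * q)%:R != 0 :> rat by rewrite natrM mulf_neq0.
have dq0 : (q + q)%:R != 0 :> rat by rewrite pnatr_eq0 -lt0n addn_gt0 q_gt0.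
rewrite det_add_orthogonal ?enum_uniq //; last first.
  move=> k l _ _ kl; apply: fmx_mul0 => x z y.
  rewrite /N; case: ifP; rewrite ?eqxx // => /andP[_ /setIdP[_ /eqP zk]] _.
  by rewrite !inE zk (negPf kl) andbF.
rewrite big_enum /=.
under eq_bigr do rewrite det_clique // card_fiber.
rewrite prodr_const det_clique // card_Z mul1r => ->.
have -> : #|[set k | k != k0]| = q.-1.
  by rewrite -cardK -(cardsC1 k0); apply: eq_card => k; rewrite !inE.
exact: kappa_centered_arith.
Qed.
End CenteredCommuting.

Local Close Scope ring_scope.

(** * Split groups of rank one *)

Local Open Scope group_scope.

(** [I] stands for the number of conjugates of [H] and [q ^ 2 + 1] for that of [U]; the second
    equation counts the nontrivial elements of [G]. *)
Lemma regular_count_arith q R I : 1 < q ->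
  (2 * I = q ^ 2 * (q ^ 2 + 1))%N ->
  (R + (q ^ 2 - 1) * (q ^ 2 + 1) + (q - 2) * I = q ^ 2 * (q - 1) * (q ^ 2 + 1) - 1)%N ->
  (2 * R = q ^ 3 * (q - 1) ^ 2)%N.
Proof.
move=> q1; have [m ->] : exists m, q = (m + 2)%N by exists (q - 2)%N; lia.
move=> iH; have iH' := congr1 (muln m) iH.
have -> : (m + 2 - 1 = m + 1)%N by lia.
have -> : ((m + 2) ^ 2 - 1 = (m + 1) * (m + 3))%N by lia.
rewrite addnK => e.
have {}e : (R + (m + 1) * (m + 3) * ((m + 2) ^ 2 + 1) + m * I + 1 =
    (m + 2) ^ 2 * (m + 1) * ((m + 2) ^ 2 + 1))%N.
  by rewrite e subnK // !muln_gt0 !addn_gt0 !orbT.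
lia.
Qed.

Lemma square_succ_arith q : 0 < q -> (q ^ 2 + 1 = (q - 1) * (q + 1) + 2)%N.
Proof. by case: q => // q _; rewrite subn1 /=; lia. Qed.

(** A nontrivial element common to [A] and [A :^ g] has both as its centraliser. *)
Lemma normedTI_cent1 (gT : finGroupType) (G A : {group gT}) : A :!=: 1 ->
  {in A^#, forall x, 'C_G[x] = A} -> normedTI A^# G 'N_G(A).
Proof.
move=> ntA cA; apply/normedTI_P; split.
- by rewrite setD_eq0 subG1.
- by rewrite normD1.
move=> g Gg; rewrite -setI_eq0 => /set0Pn[x /setIP[Ax]].
rewrite conjD1g => /setD1P[x1 Agx]; rewrite inE Gg /=.
have Ax' : x ^ g^-1 \in A^# by rewrite !inE conjg_eq1 x1 -mem_conjg.
apply/normP; rewrite -{1}(cA _ Ax') conjIg conjGid // -cent1J conjgKV.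
exact: cA.
Qed.

Lemma cent1_support (gT : finGroupType) (G A : {group gT}) (x y : gT) :
  {in A^#, forall z, 'C_G[z] \subset A} ->
  x \in G^# -> y \in class_support A^# G -> commute x y -> x \in class_support A^# G.
Proof.
move=> cA /setD1P[x1 Gx] /imset2P[z g Az Gg ->] xy.
apply/imset2P; exists (x ^ g^-1) g; rewrite ?conjgKV // !inE conjg_eq1 x1 /=.
apply: (subsetP (cA z Az)); rewrite inE groupJ ?groupV //=.
by rewrite -mem_conjg -cent1J; apply/cent1P.
Qed.

(** Since [w] inverts [m], conjugation by [m] absorbs [m * m]. It serves to remove the torus factor
    from a Bruhat form, each torus element being a square. *)
Lemma conj_inverted (gT : finGroupType) (t m w : gT) : w * m = m^-1 * w ->
  (t * (m * m) * w) ^ m = t ^ m * w.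
Proof. by move=> wm; rewrite !conjgE -!mulgA wm mulKVg. Qed.

Section SplitRankOne.
Variables (gT : finGroupType) (G B U H : {group gT}) (w : gT) (q : nat).
Hypotheses (q_gt7 : 7 < q) (q_even : ~~ odd q).
Hypotheses (frobB : [Frobenius B = U ><| H]) (sBG : B \subset G).
Hypotheses (Gw : w \in G) (w2 : w * w = 1) (abH : abelian H).
Hypothesis invHw : {in H, forall h, h ^ w = h^-1}.
Hypothesis sBBwH : B :&: B :^ w \subset H.
Hypothesis bruhat : {in G, forall g, g \in B \/
  exists b u, [/\ b \in B, u \in U & g = b * w * u]}.
Hypotheses (cardU : #|U| = (q ^ 2)%N) (cardH : #|H| = (q - 1)%N).

Let oddH : odd (q - 1).
Proof. by rewrite oddB ?(negPf q_even) //; apply: leq_trans q_gt7. Qed.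
Let defB : U ><| H = B. Proof. by case: (Frobenius_context frobB). Qed.
Let ntU : U :!=: 1. Proof. by case: (Frobenius_context frobB). Qed.
Let ntH : H :!=: 1. Proof. by case: (Frobenius_context frobB). Qed.
Let sUB : U \subset B. Proof. by have /mulG_sub[] := sdprodW defB. Qed.
Let sHB : H \subset B. Proof. by have /mulG_sub[] := sdprodW defB. Qed.
Let nUB : B \subset 'N(U). Proof. by case/sdprod_context: defB => /andP[]. Qed.
Let tiUH : U :&: H = 1. Proof. by case/sdprodP: defB. Qed.
Let tiHB : normedTI H^# B H. Proof. by case/and3P: frobB. Qed.

Lemma UH_trivial x : x \in U -> x \in H -> x = 1.
Proof. by move=> Ux Hx; apply/set1P; rewrite -[[set 1]]/(1%g : {set gT}) -tiUH inE Ux. Qed.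

Lemma w_notin_B : w \notin B.
Proof.
apply: contra ntU => Bw; rewrite -subG1; apply/subsetP => x Ux; apply/set1P.
have Bx := subsetP sUB x Ux; apply: (UH_trivial Ux); apply: (subsetP sBBwH).
by rewrite inE Bx conjGid.
Qed.

Lemma wV : w^-1 = w. Proof. by apply: (mulgI w); rewrite mulgV w2. Qed.

(** [G] is the disjoint union of [B] and the cell [B w U], where factorisations are unique because
    [U] meets [B :^ w] trivially. *)
Lemma card_SplitRankOne : #|G| = (#|B| * (q ^ 2 + 1))%N.
Proof.
pose D := [set p.1 * w * p.2 | p in setX B U].
have cardD : #|D| = (#|B| * q ^ 2)%N.
  rewrite card_in_imset ?cardsX ?cardU // => -[b u] [c v] /=.
  rewrite !inE /= => /andP[Bb Uu] /andP[Bc Uv] e.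
  have e' : (c^-1 * b) ^ w = v * u^-1.
    apply: (mulIg u); rewrite mulgKV conjgE wV -!mulgA; apply: (mulgI w).
    by rewrite (mulgA w w) w2 mul1g; apply: (mulgI c); rewrite mulKVg !mulgA.
  have vu : v * u^-1 = 1.
    apply: UH_trivial; first by rewrite groupM ?groupV.
    apply: (subsetP sBBwH); rewrite inE -{2}e' memJ_conjg !groupM ?groupV //.
      by rewrite (subsetP sUB).
    by rewrite (subsetP sUB).
  have uv : u = v by apply/esym/eqP; rewrite eq_mulgV1 vu.
  move: e; rewrite uv => /mulIg/mulIg->; by [].
have dG : G :=: B :|: D.
  apply/setP => g; rewrite inE; apply/idP/orP => [Gg|[|/imsetP[[b u]]]].
  - case: (bruhat Gg) => [|[b [u [Bb Uu ->]]]]; first by left.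
    by right; apply/imsetP; exists (b, u); rewrite ?inE ?Bb.
  - exact: (subsetP sBG).
  - rewrite !inE /= => /andP[Bb Uu] ->.
    by rewrite !groupM // (subsetP sBG) // (subsetP sUB).
rewrite dG cardsU cardD [B :&: D](_ : _ = set0) ?cards0 ?subn0.
  by rewrite mulnDr muln1 addnC.
apply/setP => g; rewrite !inE; apply/negP => /andP[Bg /imsetP[[b u]]].
rewrite !inE /= => /andP[Bb Uu] ge; case/negP: w_notin_B.
have -> : w = b^-1 * g * u^-1 by rewrite ge !mulgA mulVg mul1g mulgK.
by rewrite !groupM ?groupV // (subsetP sUB).
Qed.

Lemma normedTI_U : normedTI U^# G B.
Proof.
apply/normedTI_P; split.
- by rewrite setD_eq0 subG1.
- by rewrite subsetI sBG normD1.
move=> g Gg; rewrite -setI_eq0 => /set0Pn[x /setIP[/setD1P[x1 Ux]]].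
rewrite conjD1g => /setD1P[_ Ugx].
case: (bruhat Gg) => // -[b [u [Bb Uu ge]]]; case/eqP: x1.
rewrite ge !conjsgM (normsP nUB b Bb) in Ugx.
rewrite -(conjgKV u x); apply/eqP; rewrite conjg_eq1; apply/eqP/UH_trivial.
  by rewrite memJ_norm // groupV (subsetP (subset_trans sUB nUB)).
have Uxu : x ^ u^-1 \in U :^ w by rewrite -mem_conjg.
have sUBw : U :^ w \subset B :^ w by rewrite conjSg.
by apply: (subsetP sBBwH); rewrite inE groupJ ?groupV ?(subsetP sUB) //=
   (subsetP sUBw).
Qed.

Lemma cent1_U x : x \in U^# -> 'C_G[x] \subset U.
Proof.
move=> Ux; have := cent1_normedTI normedTI_U Ux => sCB.
apply: subset_trans (Frobenius_cent1_ker frobB Ux).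
by rewrite subsetI sCB subsetIr.
Qed.

Lemma H_square1 h : h \in H -> h * h = 1 -> h = 1.
Proof.
move=> Hh hh; apply/eqP; rewrite -order_eq1 -dvdn1.
have <- : gcdn 2 #|H| = 1%N by apply/eqP; rewrite -/(coprime _ _) coprime2n cardH.
by rewrite dvdn_gcd order_dvdG // order_dvdn expgS expg1 hh eqxx.
Qed.

Lemma memH_conj x b : x \in H^# -> b \in B -> (x ^ b \in H) = (b \in H).
Proof.
move=> Hx Bb; have [_ _ /(_ x b Hx Bb) <-] := normedTI_memJ_P tiHB.
by rewrite !inE conjg_eq1; case/setD1P: Hx => -> _.
Qed.

(** If [y = b * w * u], undoing [u] moves [x ^ y] into [B :&: B :^ w], hence into [H]. In the
    Frobenius group [B] only elements of [H] conjugate a nontrivial element of [H] into [H], so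
    [u = 1]. *)
Lemma bruhat_H x y : x \in H^# -> y \in G -> x ^ y \in H ->
  y \in H \/ exists2 b, b \in H & y = b * w.
Proof.
move=> Hx Gy Hxy; case: (bruhat Gy) => [By|[b [u [Bb Uu ye]]]].
  by left; rewrite -(memH_conj Hx By).
have Bx : x \in B by case/setD1P: Hx => _ /(subsetP sHB).
have u1 : u = 1.
  apply: (UH_trivial Uu); rewrite -groupV.
  have xy1 : x ^ y \in H^# by rewrite !inE conjg_eq1 Hxy andbT; case/setD1P: Hx.
  have Buv : u^-1 \in B by rewrite groupV (subsetP sUB).
  rewrite -(memH_conj xy1 Buv); apply: (subsetP sBBwH).
  rewrite inE groupJ ?(subsetP sHB _ Hxy) //=.
  by rewrite ye conjgM conjgK conjgM memJ_conjg groupJ.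
right; exists b; last by rewrite ye u1 mulg1.
rewrite -(memH_conj Hx Bb); move: Hxy; rewrite ye u1 mulg1 conjgM.
move=> Hxbw; have := invHw Hxbw; rewrite -(conjgM (x ^ b) w w) w2 conjg1 => ->.
by rewrite groupV.
Qed.

Lemma cent1_H x : x \in H^# -> 'C_G[x] = H.
Proof.
move=> Hx; have /setD1P[x1 Hx'] := Hx; apply/eqP; rewrite eqEsubset.
apply/andP; split; last first.
  rewrite subsetI (subset_trans sHB sBG) /=; apply/subsetP => h Hh.
  by apply/cent1P; apply: (centsP abH).
apply/subsetP => y /setIP[Gy /cent1P xy].
have xyE : x ^ y = x by rewrite conjgE -xy mulKg.
have Hxy : x ^ y \in H by rewrite xyE.
have [//|[b Hb ye]] := bruhat_H Hx Gy Hxy.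
(* A centralising element [b * w] would also invert [x], while [H] has odd order. *)
case/eqP: x1; apply: H_square1 => //; rewrite -{1}xyE ye conjgM.
have -> : x ^ b = x by rewrite conjgE (centsP abH x Hx' b Hb) mulKg.
by rewrite invHw // mulVg.
Qed.

Lemma card_norm_H : #|'N_G(H)| = (2 * (q - 1))%N.
Proof.
have w_notin_H : w \notin H by apply: contra w_notin_B; apply: (subsetP sHB).
have nHw : w \in 'N(H).
  by rewrite inE; apply/subsetP => h /imsetP[k Hk ->]; rewrite invHw // groupV.
have -> : 'N_G(H) = H :|: H :* w.
  apply/setP => y; rewrite inE [RHS]inE; apply/andP/orP => [[Gy nHy]|[Hy|]].
  - have /trivgPn[x Hx x1] := ntH; have Hx' : x \in H^# by rewrite !inE x1.
    have Hxy : x ^ y \in H by rewrite memJ_norm.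
    have [yH|[b Hb ->]] := bruhat_H Hx' Gy Hxy; first by left.
    by right; rewrite mem_rcoset mulgK.
  - by rewrite (subsetP (normG H)) // (subsetP sBG) // (subsetP sHB).
  - case/rcosetP => h Hh ->.
    split; rewrite !groupM // ?(subsetP (normG H)) //.
    by rewrite (subsetP sBG) // (subsetP sHB).
rewrite cardsU card_rcoset cardH [_ :&: _](_ : _ = set0) ?cards0.
  by rewrite subn0 mul2n addnn.
apply/setP => y; rewrite !inE; apply/negP => /andP[Hy /rcosetP[h Hh ye]].
by case/negP: w_notin_H; rewrite -(mulKg h w) -ye groupM ?groupV.
Qed.

Definition regular_set := G^# :\: (class_support U^# G :|: class_support H^# G).

(** A Frobenius group is the union of its kernel and the conjugates of its complement, so avoiding
    the conjugates of [U] and [H] means avoiding those of [B]. *)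
Lemma sub_class_support_B x : x \in class_support B G -> x != 1 ->
  x \in class_support U^# G :|: class_support H^# G.
Proof.
case/imset2P=> b g Bb Gg ->; rewrite conjg_eq1 => b1.
have /and3P[/eqP dB _ _] := Frobenius_partition frobB.
have := Bb; rewrite -dB => /bigcupP[X]; rewrite in_setU1 inE.
case/orP=> [/eqP-> Ub|/imsetP[u Uu ->]].
  by apply/orP; left; apply/imset2P; exists b g; rewrite // !inE b1.
case/imsetP=> h Hh ->; apply/orP; right; rewrite -conjgM.
apply/imset2P; exists h (u * g) => //.
by rewrite groupM // (subsetP sBG) // (subsetP sUB).
Qed.

Lemma normedTI_H : normedTI H^# G 'N_G(H).
Proof. by apply: normedTI_cent1 ntH _ => x; apply: cent1_H. Qed.

Lemma class_support_UH_disjoint :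
  class_support U^# G :&: class_support H^# G = set0.
Proof.
apply/setP => x; rewrite !inE; apply/negP => /andP[].
case/imset2P=> u g /setD1P[u1 Uu] Gg -> /imset2P[h k /setD1P[_ Hh] Gk e].
case/eqP: u1; apply/eqP; rewrite -order_eq1 -dvdn1.
rewrite -(eqP (Frobenius_coprime frobB)) dvdn_gcd order_dvdG //=.
by rewrite -(orderJ u g) e orderJ order_dvdG.
Qed.

Lemma card_regular_set : (2 * #|regular_set| = q ^ 3 * (q - 1) ^ 2)%N.
Proof.
have sG (A : {group gT}) : A \subset G -> class_support A^# G \subset G^#.
  move=> sAG; apply/subsetP => x /imset2P[z g /setD1P[z1 Az] Gg ->].
  by rewrite !inE conjg_eq1 z1 groupJ // (subsetP sAG).
have sUG := subset_trans sUB sBG; have sHG := subset_trans sHB sBG.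
have tiKL := class_support_UH_disjoint.
have cardR : (#|regular_set| + #|class_support U^# G| + #|class_support H^# G| =
              #|G| - 1)%N.
  rewrite -addnA -(cardsUI (class_support _ G)) tiKL cards0 addn0.
  have sKL : class_support U^# G :|: class_support H^# G \subset G^#.
    by rewrite subUset !sG.
  rewrite /regular_set cardsD (setIidPr sKL) subnK ?subset_leq_card //.
  by rewrite (cardsD1 1 G) group1 addnC addnK.
rewrite (card_support_normedTI normedTI_U) (card_support_normedTI normedTI_H) in cardR.
have cU : #|U^#| = (q ^ 2 - 1)%N.
  by rewrite -cardU (cardsD1 1 U) group1 addnC addnK.
have cH : #|H^#| = (q - 2)%N.
  have := cardH; rewrite (cardsD1 1 H) group1 => e.
  by rewrite -[LHS](addKn 1) e -subnDA.
have cB : #|B| = (q ^ 2 * (q - 1))%N by rewrite -(sdprod_card defB) cardU cardH.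
have cG : #|G| = (q ^ 2 * (q - 1) * (q ^ 2 + 1))%N by rewrite card_SplitRankOne cB.
have iB : #|G : B| = (q ^ 2 + 1)%N.
  by rewrite -divgS // card_SplitRankOne mulKn ?cardG_gt0.
have iH : (2 * #|G : 'N_G(H)| = q ^ 2 * (q ^ 2 + 1))%N.
  have := Lagrange (subsetIl G 'N(H)); rewrite card_norm_H cG => e.
  have q1 : 0 < q - 1 by rewrite subn_gt0; apply: leq_trans q_gt7.
  apply/eqP; rewrite -(eqn_pmul2l q1); apply/eqP.
  by rewrite mulnA [((q - 1) * 2)%N]mulnC e mulnA [((q - 1) * _)%N]mulnC.
by move: cardR; rewrite cU cH cG iB; apply: regular_count_arith iH; apply: leq_trans q_gt7.
Qed.

(** For a common prime [p], a Sylow [p]-subgroup of [B] is Sylow in [G], as [q ^ 2 + 1] is prime to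
    [#|B|]. A power [y] of [x] of order [p] is then conjugate into [B], and [x], commuting with [y],
    lies in the class support of [U] or [H]. *)
Lemma regular_order_coprime x : x \in regular_set -> coprime #[x] #|B|.
Proof.
case/setDP=> G1x; rewrite inE => /norP[nUx nHx].
have Gx : x \in G by case/setD1P: G1x.
rewrite /coprime; apply: contraT => ncop.
have /pdivP[p pr_p] : 1 < gcdn #[x] #|B|.
  by rewrite ltn_neqAle eq_sym ncop gcdn_gt0 order_gt0.
rewrite dvdn_gcd => /andP[px pB].
have [y] := Cauchy pr_p px; rewrite -cycle_subG => sYX oy; rewrite cycle_subG in sYX.
have /cycleP[k yk] := sYX.
have y1 : y != 1 by rewrite -order_eq1 oy; case: (p) pr_p => [|[]].
have Gy : y \in G by rewrite yk groupX.
have xy : commute x y by rewrite yk; apply: commuteX.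
have [P sylP] := Sylow_exists p B.
have sylGP : p.-Sylow(G) P.
  have sPG := subset_trans (pHall_sub sylP) sBG.
  apply/and3P; split=> //; first exact: pHall_pgroup sylP.
  rewrite -(Lagrange_index sBG (pHall_sub sylP)) pnatM; have /and3P[_ _ ->] := sylP.
  rewrite andbT -divgS // card_SplitRankOne mulKn ?cardG_gt0 // p'natE //.
  apply: contraL pB => pN; rewrite -(sdprod_card defB) cardU cardH Euclid_dvdM //.
  rewrite Euclid_dvdX // andbT; apply/negP => pq; move: pN.
  case/orP: pq => pq.
    by rewrite dvdn_addr ?dvdn_exp // dvdn1; case: (p) pr_p => [|[]].
  have -> : (q ^ 2 + 1 = (q - 1) * (q + 1) + 2)%N.
    by apply: square_succ_arith; apply: leq_trans q_gt7.
  rewrite dvdn_addr ?dvdn_mulr // dvdn_prime2 // => /eqP p2.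
  by rewrite p2 dvdn2 oddH in pq.
have By : y \in class_support B G.
  have [||g Gg sYP] := Sylow_Jsub sylGP (_ : <[y]> \subset G) _.
  - by rewrite cycle_subG.
  - by rewrite /pgroup -/#[y] oy pnat_id.
  apply/imset2P; exists (y ^ g) g^-1; rewrite ?groupV ?conjgK //.
  by apply/(subsetP (pHall_sub sylP))/(subsetP sYP); rewrite memJ_conjg cycle_id.
have := sub_class_support_B By y1; rewrite inE => /orP[] sy.
  by case/negP: nUx; apply: (cent1_support cent1_U G1x sy xy).
by case/negP: nHx; apply: (cent1_support _ G1x sy xy) => z /cent1_H ->.
Qed.

Lemma regular_setJ : {in regular_set & G, forall x g, x ^ g \in regular_set}.
Proof.
have suppJ (A : {set gT}) x g : g \in G ->
    (x ^ g \in class_support A G) = (x \in class_support A G).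
  move=> Gg; apply/imset2P/imset2P=> -[a h Aa Gh e].
    by exists a (h * g^-1); rewrite ?groupM ?groupV // conjgM -e conjgK.
  by exists a (h * g); rewrite ?groupM // conjgM -e.
move=> x g; rewrite !inE => /and3P[nUH x1 Gx] Gg.
by rewrite !suppJ // nUH conjg_eq1 x1 groupJ.
Qed.

Lemma regular_set_cent :
  {in regular_set, forall x, {in 'C_G[x]^#, forall y, y \in regular_set}}.
Proof.
move=> x /setDP[G1x]; rewrite inE => /norP[nUx nHx] y /setD1P[y1 /setIP[Gy /cent1P xy]].
rewrite !inE y1 Gy !andbT; apply/norP; split.
  by apply: contra nUx => sy; apply: (cent1_support cent1_U G1x sy).
apply: contra nHx => sy; apply: (cent1_support _ G1x sy) => // z Hz.
by rewrite cent1_H.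
Qed.

Lemma regular_expg_neq1 x m : x \in regular_set -> m %| #|B| -> x ^+ m != 1.
Proof.
move=> Rx mB; have /setDP[/setD1P[x1 _] _] := Rx; apply: contra x1.
rewrite -order_dvdn -order_eq1 -dvdn1 => xm.
by rewrite -(eqP (regular_order_coprime Rx)) dvdn_gcd dvdnn (dvdn_trans xm mB).
Qed.

Lemma regular_bruhat x : x \in regular_set ->
  exists u b, [/\ u \in U, b \in B & x ^ u = b * w].
Proof.
case/setDP=> /setD1P[x1 Gx] nBx; case: (bruhat Gx) => [Bx|[b [u [Bb Uu xe]]]].
  case/negP: nBx; apply: sub_class_support_B x1.
  by apply/imset2P; exists x 1; rewrite ?conjg1.
exists u^-1, (u * b); split; first by rewrite groupV.
  by rewrite groupM // (subsetP sUB).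
by rewrite conjgE invgK xe !mulgA mulgK.
Qed.

End SplitRankOne.

(* Arithmetic of the class count *)
Local Close Scope group_scope.

(** [s] is the size of the class support of a group of order [m] and index [e] in its normaliser, in
    a group of order [g]; thus [s / g = (1 - 1/m) / e], at least [(4/5) / 4]. *)
Lemma class_size_ge m e s g : 4 < m -> e <= 4 -> (s * (e * m) = (m - 1) * g)%N ->
  g <= 5 * s.
Proof.
move=> m4 e4 eq_s; rewrite -(leq_pmul2l (_ : 0 < 4 * m)) ?muln_gt0 /=; last by lia.
have le1 : 4 * m * g <= 5 * ((m - 1) * g) by rewrite mulnA leq_mul2r; apply/orP; right; lia.
apply: leq_trans le1 _; rewrite -eq_s; nia.
Qed.

Lemma class_size_ge2 m e s g : 4 < m -> e <= 2 -> (s * (e * m) = (m - 1) * g)%N ->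
  2 * g <= 5 * s.
Proof.
move=> m4 e4 eq_s; rewrite -(leq_pmul2l (_ : 0 < 2 * m)) ?muln_gt0 /=; last by lia.
have le1 : 2 * m * (2 * g) <= 5 * ((m - 1) * g).
  by rewrite [2 * g]mulnC [2 * m * _]mulnCA -mulnCA mulnC -mulnA; nia.
apply: leq_trans le1 _; rewrite -eq_s; nia.
Qed.

(** The proportion of regular elements is [q (q - 1) / (2 (q^2 + 1))], below 1/2. The weaker bound
    3/5 excludes three classes of proportion at least 1/5, and also one of at least 2/5 beside
    another of at least 1/5. *)
Lemma few_classes_arith q R : 7 < q -> (2 * R = q ^ 3 * (q - 1) ^ 2)%N ->
  5 * R < 3 * (q ^ 2 * (q - 1) * (q ^ 2 + 1)).
Proof.
move=> q7; have [m qm] : exists m, q = (m + 1)%N by exists (q - 1)%N; lia.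
rewrite qm addnK => e; have m0 : 6 < m by lia.
rewrite -(ltn_pmul2l (_ : 0 < 2)) // mulnCA e; nia.
Qed.

(** A single class would give [q (q - 1) / (q^2 + 1) = 2 (m - 1) / (e m)]. The sizes disagree unless
    [e = 2], where [m (q + 1) = q^2 + 1] and [q + 1] would divide 2. *)
Lemma one_class_arith q m e : 7 < q -> 4 < m -> 0 < e -> e <= 4 ->
  (q ^ 3 * (q - 1) ^ 2 * (e * m) = 2 * ((m - 1) * (q ^ 2 * (q - 1) * (q ^ 2 + 1))))%N -> False.
Proof.
move=> q7 m4 e0 e4 E.
have {}E : (q * (q - 1) * (e * m) = 2 * ((m - 1) * (q ^ 2 + 1)))%N.
  have c0 : 0 < q ^ 2 * (q - 1) by rewrite muln_gt0 expn_gt0; lia.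
  apply/eqP; rewrite -(eqn_pmul2l c0); apply/eqP; move: E; lia.
have [k qk] : exists k, q = (k + 1)%N by exists (q - 1)%N; lia.
have [l ml] : exists l, m = (l + 1)%N by exists (m - 1)%N; lia.
move: E; rewrite qk ml !addnK => E.
have : (e == 1) || (e == 2) || (e == 3) || (e == 4) by lia.
move=> /orP[/orP[/orP[]|]|] /eqP ee; rewrite {e e0 e4}ee in E.
- nia.
- have E2 : ((l + 1) * (k + 2) = k * (k + 2) + 2)%N by lia.
  have [lk|lk] := leqP k l; nia.
- nia.
- nia.
Qed.

Lemma two_classes_mass m1 m2 s1 s2 c N : 0 < m1 -> 0 < m2 ->
  (s1 * (4 * m1) = (m1 - 1) * (c * N))%N -> (s2 * (4 * m2) = (m2 - 1) * (c * N))%N ->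
  (4 * (m1 * m2) * (s1 + s2) + (m1 + m2) * (c * N) = 2 * (m1 * m2) * (c * N))%N.
Proof.
case: m1 m2 => // l1 [|l2] // _ _; rewrite !subSS !subn0 => E1 E2.
have -> : (4 * (l1.+1 * l2.+1) * (s1 + s2) =
           l2.+1 * (s1 * (4 * l1.+1)) + l1.+1 * (s2 * (4 * l2.+1)))%N by lia.
by rewrite E1 E2; move: (c * N)%N => d; lia.
Qed.

(** Comparing masses gives [k (m1 + m2) = 2 (q + 1)]. The odd number [k] then divides [q + 1] and
    [q^2 + 1 = (q - 1)(q + 1) + 2], hence 2, so it is 1. *)
Lemma two_classes_arith q m1 m2 k s1 s2 : 7 < q -> ~~ odd q -> 4 < m1 -> 4 < m2 ->
  (m1 * m2 * k = q ^ 2 + 1)%N ->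
  (2 * (s1 + s2) = q ^ 3 * (q - 1) ^ 2)%N ->
  (s1 * (4 * m1) = (m1 - 1) * (q ^ 2 * (q - 1) * (q ^ 2 + 1)))%N ->
  (s2 * (4 * m2) = (m2 - 1) * (q ^ 2 * (q - 1) * (q ^ 2 + 1)))%N ->
  (m1 * m2 = q ^ 2 + 1)%N /\ (m1 + m2 = 2 * (q + 1))%N.
Proof.
move=> q7 qe m14 m24 mk sE E1 E2.
have c0 : 0 < q ^ 2 * (q - 1) by rewrite muln_gt0 expn_gt0; lia.
have m12 : 0 < m1 * m2 by rewrite muln_gt0; lia.
have mass := two_classes_mass (ltnW (ltnW (ltnW (ltnW m14)))) (ltnW (ltnW (ltnW (ltnW m24)))) E1 E2.
have ksum : (k * (m1 + m2) = 2 * (q + 1))%N.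
  have cE : (q ^ 3 * (q - 1) ^ 2 = q ^ 2 * (q - 1) * (q * (q - 1)))%N by lia.
  move: mass c0; rewrite [(4 * _)%N](_ : _ = 2 * (m1 * m2) * 2)%N; last by lia.
  rewrite -mulnA sE cE -mk; move: (q ^ 2 * (q - 1))%N => c mass c0.
  have {}mass : (2 * (q * (q - 1)) + k * (m1 + m2) = 2 * (m1 * m2 * k))%N.
    apply/eqP; rewrite -(eqn_pmul2l m12) -(eqn_pmul2l c0); apply/eqP.
    by move: mass; move: (m1 * m2)%N => p; move: (q * (q - 1))%N (m1 + m2)%N; lia.
  move: mass; rewrite mk; clear -q7; have [p ->] : exists p, q = (p + 1)%N.
    by exists (q - 1)%N; lia.
  by rewrite addnK; move: (k * _)%N; lia.
have kN : k %| q ^ 2 + 1 by rewrite -mk dvdn_mull.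
have k2 : coprime k 2.
  by rewrite coprimen2; apply: dvdn_odd kN _; rewrite oddD oddX /= (negPf qe).
have kq : k %| q + 1 by rewrite -(Gauss_dvdr _ k2) -ksum dvdn_mulr.
have k1 : k = 1%N.
  apply/eqP; rewrite -dvdn1 -(Gauss_dvdr _ k2) muln1.
  have NE : (q ^ 2 + 1 = (q - 1) * (q + 1) + 2)%N.
    clear -q7; have [p ->] : exists p, q = (p + 1)%N by exists (q - 1)%N; lia.
    by rewrite addnK; lia.
  by rewrite NE dvdn_addr ?dvdn_mull in kN.
by rewrite k1 muln1 mul1n in mk ksum.
Qed.

(** [X^2 - 2 (q + 1) X + q^2 + 1] has discriminant [8 q = (2 r)^2]; this is where [r] enters. *)
Lemma quadratic_roots q r m1 m2 : r <= q -> (r ^ 2 = 2 * q)%N ->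
  (m1 * m2 = q ^ 2 + 1)%N -> (m1 + m2 = 2 * (q + 1))%N ->
  (m1 = q - r + 1 /\ m2 = q + r + 1)%N \/ (m2 = q - r + 1 /\ m1 = q + r + 1)%N.
Proof.
move=> rq r2 P S.
have [l lE] : exists l, q = (r + l)%N by exists (q - r)%N; lia.
have : ((m1%:Z - (q%:Z - r%:Z + 1)) * (m1%:Z - (q%:Z + r%:Z + 1)) = 0)%R by nia.
move/eqP; rewrite GRing.mulf_eq0 => /orP[]; lia.
Qed.

Local Open Scope group_scope.

(** * Centralisers of regular elements and their classes *)

Section RegularClasses.
Variables (gT : finGroupType) (G : {group gT}) (R : {set gT}) (q : nat).
Hypotheses (q_gt7 : 7 < q) (q_even : ~~ odd q) (G_3 : ~~ (3 %| #|G|)).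
Hypothesis cardG_q : #|G| = (q ^ 2 * (q - 1) * (q ^ 2 + 1))%N.
Hypothesis cardR : (2 * #|R| = q ^ 3 * (q - 1) ^ 2)%N.
Hypothesis sRG : R \subset G^#.
Hypothesis RJ : {in R & G, forall x g, x ^ g \in R}.
Hypothesis Rcent : {in R, forall x, {in 'C_G[x]^#, forall y, y \in R}}.
Hypothesis Rcop : {in R, forall x, coprime #[x] (q ^ 2 * (q - 1))}.
Hypothesis Rab : {in R, forall x, abelian 'C_G[x]}.
Hypothesis R4 : {in R, forall x, #|x ^: G :&: 'C_G[x]| <= 4}.

Let A x := 'C_G[x]%G.
Let S x := class_support (A x)^# G.

Let RG x : x \in R -> (x != 1) && (x \in G).
Proof. by move/(subsetP sRG); rewrite !inE. Qed.

Let selfA x : x \in R -> x \in (A x)^#.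
Proof. by case/RG/andP=> x1 Gx; rewrite in_setD1 x1 inE Gx cent1id. Qed.

Let ntA x : x \in R -> A x :!=: 1.
Proof. by move/selfA/setD1P=> [x1 Ax]; apply/trivgPn; exists x. Qed.

(** Being abelian, ['C_G[x]] lies in ['C_G[y]]; as [y] is again in [R], the roles can be
    exchanged. *)
Lemma regular_cent_eq x y : x \in R -> y \in (A x)^# -> 'C_G[y] = A x.
Proof.
move=> Rx Axy; have Ry := Rcent Rx Axy; have /setD1P[_ /setIP[Gy cxy]] := Axy.
have Gx : x \in G by case/andP: (RG Rx).
have sub u v : u \in R -> v \in 'C_G[u] -> 'C_G[u] \subset 'C_G[v].
  move=> Ru Auv; rewrite subsetI subsetIl /=; apply/subsetP => z Auz.
  by apply/cent1P; apply: (centsP (Rab Ru)).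
apply/eqP; rewrite eqEsubset !sub // inE ?Gx ?Gy //; by rewrite cent1C.
Qed.

Lemma regular_normedTI x : x \in R -> normedTI (A x)^# G 'N_G(A x).
Proof.
by move=> Rx; apply: normedTI_cent1 (ntA Rx) _ => y; apply: regular_cent_eq.
Qed.

Let dvdA x : x \in R -> #|A x| %| q ^ 2 + 1.
Proof.
move=> Rx; have : #|A x| %| #|G| by rewrite cardSg ?subsetIl.
rewrite cardG_q Gauss_dvdr // coprime_sym; apply: contraT => ncop.
have /pdivP[p pr_p] : 1 < gcdn (q ^ 2 * (q - 1)) #|A x|.
  by rewrite ltn_neqAle eq_sym ncop gcdn_gt0 cardG_gt0 orbT.
rewrite dvdn_gcd => /andP[pq pA]; have [y Ay oy] := Cauchy pr_p pA.
have y1 : y != 1 by rewrite -order_eq1 oy; case: (p) pr_p => [|[]].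
have Ry : y \in R by apply: (Rcent Rx); rewrite in_setD1 y1.
have := Rcop Ry; rewrite oy prime_coprime // pq //.
Qed.

(** The order is odd, as a divisor of [q ^ 2 + 1], and not a multiple of 3, so a nontrivial one is
    at least 5. *)
Let A_gt4 x : x \in R -> 4 < #|A x|.
Proof.
move=> Rx; have A1 : 1 < #|A x| by rewrite cardG_gt1 ntA.
have A3 : ~~ (3 %| #|A x|).
  by apply: contra G_3 => /dvdn_trans -> //; rewrite cardSg ?subsetIl.
have A2 : odd #|A x|.
  by apply: dvdn_odd (dvdA Rx) _; rewrite oddD oddX /= (negPf q_even).
by move: #|A x| A1 A3 A2 => [|[|[|[|[|]]]]].
Qed.

(** The stabiliser of [x] in the normaliser is [A x], so the index counts conjugates of [x] that lie
    in ['C_G[x]]. *)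
Let indexA x : x \in R ->
  [/\ 0 < #|'N_G(A x) : A x|, #|'N_G(A x) : A x| <= 4 & #|'N_G(A x) : A x| != 3].
Proof.
move=> Rx; split; first exact: indexg_gt0.
  have cN : 'C_('N_G(A x))[x] = A x.
    rewrite setIAC; apply/setIidPl; exact: normG.
  rewrite -{2}cN index_cent1; apply: leq_trans (R4 Rx).
  apply/subset_leq_card/subsetP => y /imsetP[g /setIP[Gg nAg] ->].
  rewrite inE memJ_class //= memJ_norm //.
  by case/setD1P: (selfA Rx).
apply: contraNneq G_3 => <-.
by apply: dvdn_trans (dvdn_indexg _ _) (cardSg (subsetIl _ _)).
Qed.

Let cardS x : x \in R ->
  (#|S x| * (#|'N_G(A x) : A x| * #|A x|) = (#|A x| - 1) * #|G|)%N.
Proof.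
move=> Rx; rewrite (card_support_normedTI (regular_normedTI Rx)).
have -> : #|(A x)^#| = (#|A x| - 1)%N.
  by rewrite (cardsD1 1 (A x)) group1 addnC addnK.
have sAN : A x \subset 'N_G(A x) by rewrite subsetI subsetIl normG.
by rewrite -!mulnA [(#|_ : A x| * _)%N]mulnC Lagrange // [(#|G : _| * _)%N]mulnC
  Lagrange ?subsetIl.
Qed.

Let sSR x : x \in R -> S x \subset R.
Proof.
move=> Rx; apply/subsetP => y /imset2P[z g Az Gg ->]; apply: RJ => //.
exact: Rcent Rx _ Az.
Qed.

Let S_conj x z : x \in R -> z \in S x -> exists2 g, g \in G & 'C_G[z] = A x :^ g.
Proof.
move=> Rx /imset2P[y g Ay Gg ->]; exists g => //.
by rewrite -(regular_cent_eq Rx Ay) conjIg conjGid // cent1J.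
Qed.

Let S_disjoint x y : x \in R -> y \in R -> y \notin S x -> S x :&: S y = set0.
Proof.
move=> Rx Ry; apply: contraNeq => /set0Pn[z /setIP[Sxz Syz]].
have [g Gg zg] := S_conj Rx Sxz; have [h Gh zh] := S_conj Ry Syz.
apply/imset2P; exists (y ^ (h * g^-1)) (g * h^-1); rewrite ?groupM ?groupV //.
  rewrite in_setD1 conjg_eq1; case/setD1P: (selfA Ry) => -> Ayy /=.
  have : y ^ h \in A x :^ g by rewrite -zg zh memJ_conjg.
  by rewrite mem_conjg -conjgM.
by rewrite -conjgM !mulgA mulgKV mulgV conjg1.
Qed.

(* With [P] a Sylow subgroup containing [y] in [A x] and [z != 1] central in [P],
   [z] lies in ['C_G[y] = A x], hence [P] lies in ['C_G[z] = A x]. *)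
Let A_Sylow x p : x \in R -> prime p -> p %| #|A x| ->
  exists2 P : {group gT}, p.-Sylow(G) P & P \subset A x.
Proof.
move=> Rx pr_p pA; have [y Ay oy] := Cauchy pr_p pA.
have y1 : y != 1 by rewrite -order_eq1 oy; case: (p) pr_p => [|[]].
have Ay' : y \in (A x)^# by rewrite in_setD1 y1.
have Gy : y \in G by case/setIP: Ay.
have [||P sylP sYP] := Sylow_superset (_ : <[y]> \subset G) (_ : p.-group <[y]>).
- by rewrite cycle_subG.
- by rewrite /pgroup -/#[y] oy pnat_id.
exists P => //; have Py : y \in P by rewrite -cycle_subG.
have pP := pHall_pgroup sylP; have sPG := pHall_sub sylP.
have ntP : P :!=: 1 by apply/trivgPn; exists y.
have /trivgPn[z /setIP[Pz cPz] z1] : 'Z(P) != 1 by rewrite (center_nil_eq1 (pgroup_nil pP)).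
have Az : z \in (A x)^#.
  rewrite in_setD1 z1 -(regular_cent_eq Rx Ay') inE (subsetP sPG) //=.
  by apply/cent1P; apply: (centP cPz).
rewrite -(regular_cent_eq Rx Az) subsetI sPG /=; apply/subsetP => t Pt.
by apply/cent1P; apply/esym; apply: (centP cPz).
Qed.

(** A common prime would place full Sylow subgroups of [G], which are conjugate, in both
    centralisers. *)
Let S_coprime x y : x \in R -> y \in R -> y \notin S x -> coprime #|A x| #|A y|.
Proof.
move=> Rx Ry nSy; apply: contraT => ncop.
have /pdivP[p pr_p] : 1 < gcdn #|A x| #|A y|.
  by rewrite ltn_neqAle eq_sym ncop gcdn_gt0 cardG_gt0.
rewrite dvdn_gcd => /andP[px py].
have [P sylP sPA] := A_Sylow Rx pr_p px; have [Q sylQ sQA] := A_Sylow Ry pr_p py.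
have [g Gg QP] := Sylow_trans sylP sylQ.
have /trivgPn[t Qt t1] : Q :!=: 1.
  rewrite -cardG_gt1 (card_Hall sylQ) p_part_gt1 mem_primes pr_p cardG_gt0.
  by rewrite (dvdn_trans py) ?cardSg ?subsetIl.
have : t \in S x :&: S y; last by rewrite (S_disjoint Rx Ry nSy) inE.
rewrite inE; apply/andP; split; apply/imset2P.
  exists (t ^ g^-1) g; rewrite ?conjgKV // in_setD1 conjg_eq1 t1.
  by apply: (subsetP sPA); rewrite -mem_conjg -QP.
by exists t 1; rewrite ?conjg1 // in_setD1 t1 (subsetP sQA).
Qed.

Let few_classes : 5 * #|R| < 3 * #|G|.
Proof. by rewrite cardG_q; apply: few_classes_arith. Qed.

Let S_gt x : x \in R -> #|G| <= 5 * #|S x|.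
Proof.
by move=> Rx; have [_ e4 _] := indexA Rx; apply: class_size_ge e4 (cardS Rx); apply: A_gt4.
Qed.

Let pair_bound x y : x \in R -> y \in R -> y \notin S x -> #|S x| + #|S y| <= #|R|.
Proof.
move=> Rx Ry nxy; rewrite -cardsUI (S_disjoint Rx Ry nxy) cards0 addn0.
by rewrite subset_leq_card // subUset !sSR.
Qed.

Let index4 x y : x \in R -> y \in R -> y \notin S x ->
  #|'N_G(A x) : A x| = 4 /\ #|'N_G(A y) : A y| = 4.
Proof.
move=> Rx Ry nxy; have le_xy := pair_bound Rx Ry nxy.
have not2 z t : z \in R -> t \in R -> #|S z| + #|S t| <= #|R| -> #|'N_G(A z) : A z| = 4.
  move=> Rz Rt le_zt; have [e0 e4 e3] := indexA Rz.
  have [e2|e2] := leqP (#|'N_G(A z) : A z|) 2.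
    have := class_size_ge2 (A_gt4 Rz) e2 (cardS Rz); have := S_gt Rt.
    move: le_zt few_classes; move: #|S z| #|S t| #|R| #|G|; clear; lia.
  by move: #|_ : _| e0 e4 e3 e2 => [|[|[|[|[|]]]]].
by split; [apply: not2 Ry le_xy | apply: not2 Rx _; rewrite // addnC].
Qed.

Let card_norm x : x \in R -> #|'N_G(A x) : A x| = 4 -> #|'N_G(A x)| = (4 * #|A x|)%N.
Proof.
move=> Rx <-; rewrite mulnC Lagrange //.
by rewrite subsetI subsetIl normG.
Qed.

Lemma regular_two_classes r : r <= q -> (r ^ 2 = 2 * q)%N ->
  exists x1 x2, [/\ x1 \in R, x2 \in R, R = S x1 :|: S x2 & S x1 :&: S x2 = set0] /\
    [/\ #|A x1| = (q - r + 1)%N, #|A x2| = (q + r + 1)%N,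
    #|'N_G(A x1)| = (4 * #|A x1|)%N & #|'N_G(A x2)| = (4 * #|A x2|)%N].
Proof.
move=> rq r2.
have [x Rx] : exists x, x \in R.
  apply/set0Pn; apply: contraTneq few_classes => R0.
  have := cardR; rewrite R0 cards0 muln0 => /esym/eqP.
  rewrite muln_eq0 !expn_eq0 !andbT subn_eq0.
  by case/orP=> [/eqP q0|q1]; have := q_gt7; rewrite ?q0 // ltnNge (leq_trans q1).
have [y Ry nxy] : exists2 y, y \in R & y \notin S x.
  apply/subsetPn; apply/negP => sRS.
  have RE : S x = R by apply/eqP; rewrite eqEsubset sSR.
  have [e0 e4 _] := indexA Rx; apply: (one_class_arith q_gt7 (A_gt4 Rx) e0 e4).
  by rewrite -cardG_q -(cardS Rx) RE -cardR -mulnA.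
have RE : R = S x :|: S y.
  apply/eqP; rewrite eqEsubset [X in _ && X]subUset !sSR // !andbT.
  apply: contraT => /subsetPn[z Rz]; rewrite inE => /norP[nxz nyz].
  have le3 : #|S x| + #|S y| + #|S z| <= #|R|.
    rewrite -[(#|S x| + _)%N]cardsUI (S_disjoint Rx Ry nxy) cards0 addn0 -cardsUI.
    rewrite setIUl (S_disjoint Rx Rz nxz) (S_disjoint Ry Rz nyz) setU0 cards0 addn0.
    by rewrite subset_leq_card // !subUset !sSR.
  have := S_gt Rx; have := S_gt Ry; have := S_gt Rz; move: le3 few_classes.
  by move: #|S x| #|S y| #|S z| #|R| #|G|; clear; lia.
have [ex ey] := index4 Rx Ry nxy.
have cx := card_norm Rx ex; have cy := card_norm Ry ey.
have /dvdnP[k kE] : #|A x| * #|A y| %| q ^ 2 + 1.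
  by rewrite Gauss_dvd ?dvdA // S_coprime.
have sE : (2 * (#|S x| + #|S y|) = q ^ 3 * (q - 1) ^ 2)%N.
  by rewrite -cardsUI (S_disjoint Rx Ry nxy) cards0 addn0 -RE cardR.
have Ex := cardS Rx; have Ey := cardS Ry; rewrite ex cardG_q in Ex; rewrite ey cardG_q in Ey.
have [P Sm] := two_classes_arith q_gt7 q_even (A_gt4 Rx) (A_gt4 Ry)
  (etrans (mulnC _ _) (esym kE)) sE Ex Ey.
case: (quadratic_roots rq r2 P Sm) => [[mx my]|[my mx]].
  by exists x, y; split; split=> //; apply: S_disjoint.
exists y, x; split; split=> //; first by rewrite setUC.
by rewrite setIC; apply: S_disjoint.
Qed.
End RegularClasses.

(** * Products of tree counts over families of conjugates *)

Lemma kappa_conjugates (gT : finGroupType) (G : {group gT}) (I : finType)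
    (A L : I -> {group gT}) :
  (forall i, A i \subset G) ->
  (forall i, {in (A i)^#, forall x, 'C_G[x] \subset A i}) ->
  (forall i, normedTI (A i)^# G (L i)) ->
  (forall i j, i != j ->
     class_support (A i)^# G :&: class_support (A j)^# G = set0) ->
  {in G^#, forall x, exists i, x \in class_support (A i)^# G} ->
  kappa_C G = (\prod_i \prod_(X in A i :^: G) kappa_C X)%N.
Proof.
move=> sAG cA tiA disjA covA.
have supp i X x : X \in A i :^: G -> x \in X^# -> x \in class_support (A i)^# G.
  case/imsetP=> g Gg ->; rewrite -conjD1g => Ax.
  by apply/imset2P; exists (x ^ g^-1) g; rewrite -?mem_conjg ?conjgKV.
have eq_index i j X Y x : X \in A i :^: G -> Y \in A j :^: G -> x \in X^# ->
    x \in Y -> i = j.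
  move=> Xi Yj X1x Yx; apply/eqP; apply: contraT => /disjA ij.
  have : x \in set0; last by rewrite inE.
  rewrite -ij inE (supp _ _ _ Xi X1x); apply: supp Yj _.
  by rewrite in_setD1 Yx andbT; case/setD1P: X1x.
have ntX i X : X \in A i :^: G -> exists x, x \in X^#.
  case/imsetP=> g _ ->; have /and3P[/set0Pn[x Ax] _ _] := tiA i.
  by exists (x ^ g); rewrite -conjD1g memJ_conjg.
rewrite (@kappa_block _ G (\bigcup_i (A i :^: G))).
- apply: partition_disjoint_bigcup => i j ij.
  rewrite -setI_eq0; apply: contraNT ij => /set0Pn[X /setIP[Xi Xj]].
  have [x Xx] := ntX _ _ Xi; have /setD1P[_ Xx'] := Xx.
  by apply/eqP; apply: eq_index Xi Xj Xx Xx'.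
- move=> X /bigcupP[i _ /imsetP[g Gg ->]].
  by rewrite group1 -{1}(conjGid Gg) conjSg sAG.
- move=> X /bigcupP[i _ /imsetP[g Gg ->]] x; rewrite -conjD1g => Ax y Gy xy.
  rewrite mem_conjg; apply: (subsetP (cA i (x ^ g^-1) _)).
    by rewrite -mem_conjg.
  rewrite inE groupJ ?groupV //= -mem_conjg -cent1J conjgKV.
  by apply/cent1P.
- move=> X Y /bigcupP[i _ Xi] /bigcupP[j _ Yj] x Xx Yx.
  have ij := eq_index _ _ _ _ _ Xi Yj Xx Yx; rewrite -{j}ij in Yj.
  case/imsetP: Xi Xx => g Gg ->; case/imsetP: Yj Yx => h Gh -> Yx Xx.
  have /and3P[_ /trivIsetP tI _] := tiA i.
  have Ygh : (A i)^# :^ g = (A i)^# :^ h.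
    apply/eqP; apply: contraT => /tI; rewrite !imset_f // => /(_ isT isT).
    rewrite -setI_eq0 => /eqP gh; have : x \in set0; last by rewrite inE.
    rewrite -gh !conjD1g inE Xx in_setD1 Yx andbT; by case/setD1P: Xx.
  by move: Ygh; rewrite !conjD1g => /(congr1 (setU 1)); rewrite !setD1K ?group1.
move=> x /covA[i /imset2P[y g Ay Gg ->]]; exists (A i :^ g).
  by apply/bigcupP; exists i => //; apply: imset_f.
by rewrite memJ_conjg; case/setD1P: Ay.
Qed.

Lemma kappa_conjugates_abelian (gT : finGroupType) (G A : {group gT}) :
  abelian A ->
  (\prod_(X in A :^: G) kappa_C X = (#|A| ^ (#|A| - 2)) ^ #|G : 'N_G(A)|)%N.
Proof.
move=> abA; rewrite -card_conjugates -prod_nat_const; apply: eq_bigr => X.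
by case/imsetP=> g _ ->; rewrite kappa_abelian ?abelianJ // cardJg.
Qed.

Lemma kappa_rank_one (gT : finGroupType) (G U H A1 A2 LU LH L1 L2 : {group gT}) :
  [/\ U \subset G, H \subset G, A1 \subset G & A2 \subset G] ->
  [/\ {in U^#, forall x, 'C_G[x] \subset U}, {in H^#, forall x, 'C_G[x] \subset H},
      {in A1^#, forall x, 'C_G[x] \subset A1} & {in A2^#, forall x, 'C_G[x] \subset A2}] ->
  [/\ normedTI U^# G LU, normedTI H^# G LH, normedTI A1^# G L1 & normedTI A2^# G L2] ->
  class_support U^# G :&: class_support H^# G = set0 ->
  class_support A1^# G :&: class_support A2^# G = set0 ->
  regular_set G U H = class_support A1^# G :|: class_support A2^# G ->
  kappa_C G = (\prod_(X in U :^: G) kappa_C X * \prod_(X in H :^: G) kappa_C X *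
    \prod_(X in A1 :^: G) kappa_C X * \prod_(X in A2 :^: G) kappa_C X)%N.
Proof.
move=> [sU sH sA1 sA2] [cU cH cA1 cA2] [tU tH t1 t2] dUH d12 dR.
pose A (i : 'I_4) : {group gT} := nth U [:: U; H; A1; A2] i.
pose L (i : 'I_4) : {group gT} := nth LU [:: LU; LH; L1; L2] i.
have regular X Y : X \in [:: U; H] -> Y \in [:: A1; A2] ->
    class_support X^# G :&: class_support Y^# G = set0.
  move=> XUH YA; apply/setP => x; rewrite in_set0; apply/negP => /setIP[Xx Yx].
  have : x \in regular_set G U H.
    by rewrite dR inE; move: YA Yx; rewrite !inE => /orP[]/eqP-> ->; rewrite ?orbT.
  case/setDP=> _; rewrite inE => /negP[].
  by move: XUH Xx; rewrite !inE => /orP[]/eqP-> ->; rewrite ?orbT.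
rewrite (@kappa_conjugates _ G _ A L).
- by rewrite !big_ord_recl big_ord0 muln1 !mulnA.
- by case=> -[|[|[|[|//]]]].
- by case=> -[|[|[|[|//]]]].
- by case=> -[|[|[|[|//]]]].
- move=> i j; wlog ij : i j / i < j.
    move=> wl ij; have [/wl|/wl|/val_inj e] := ltngtP i j; first exact.
      by rewrite eq_sym setIC; apply.
    by rewrite e eqxx in ij.
  move=> _; move: i j ij; case=> -[|[|[|[|//]]]] ? [] [|[|[|[|//]]]] ? //= _;
    by [exact: dUH | exact: d12 | apply: regular; rewrite !inE eqxx ?orbT].
move=> x G1x; have [Rx|] := boolP (x \in regular_set G U H).
  move: Rx; rewrite dR => /setUP[] Ax.
    by exists (inord 2); rewrite /A inordK.
  by exists (inord 3); rewrite /A inordK.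
rewrite inE G1x andbT negbK => /setUP[] Ax.
  by exists (inord 0); rewrite /A inordK.
by exists (inord 1); rewrite /A inordK.
Qed.

Local Close Scope group_scope.

(** * Suzuki groups *)

Local Open Scope ring_scope.

(** A matrix commuting with [z] is determined by the image of the cyclic vector [v]. Expanding
    [v *m y1] in the basis [v *m z ^+ i] therefore exhibits [y1] as a polynomial in [z]. *)
Lemma cyclic_centralizer (F : fieldType) (m : nat) (v : 'rV[F]_m.+1) (z y1 y2 : 'M[F]_m.+1) :
  \matrix_(i < m.+1) (v *m z ^+ i) \in unitmx ->
  y1 * z = z * y1 -> y2 * z = z * y2 -> y1 * y2 = y2 * y1.
Proof.
set K := \matrix_i _ => Ku y1z y2z.
pose p := \sum_(i < m.+1) (v *m y1 *m invmx K) ord0 i *: z ^+ i.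
have comm_p (y : 'M[F]_m.+1) : y * z = z * y -> y * p = p * y.
  move=> yz; rewrite mulr_sumr mulr_suml; apply: eq_bigr => i _.
  rewrite -scalerAr -scalerAl; congr (_ *: _).
  exact: (commrX i (yz : GRing.comm y z)).
suff -> : y1 = p by rewrite comm_p.
have vp : v *m y1 = v *m p.
  rewrite -[LHS](mulmxKV Ku) mulmx_sum_row mulmx_sumr; apply: eq_bigr => i _.
  by rewrite rowK scalemxAr.
have : K *m (y1 - p) = 0.
  apply/row_matrixP => i; rewrite row_mul rowK row0 -mulmxA.
  have cz : GRing.comm (y1 - p) z.
    by rewrite /GRing.comm mulrBl mulrBr y1z -comm_p.
  have /= := commrX i cz; rewrite /GRing.comm -!mulmxE => <-.
  by rewrite mulmxA mulmxBr vp subrr mul0mx.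
move/(congr1 (mulmx (invmx K))); rewrite mulKmx // mulmx0.
exact: subr0_eq.
Qed.

Lemma poly_eigen (F : fieldType) (z : 'M[F]_4) (c : 'cV[F]_4) (m s t : F) :
  z ^+ 4 + s *: z ^+ 3 + t *: z ^+ 2 + s *: z + 1 = 0 -> c != 0 ->
  z *m c = m *: c -> m ^+ 4 + s * m ^+ 3 + t * m ^+ 2 + s * m + 1 = 0.
Proof.
move=> pz c0 zc; have zX k : z ^+ k *m c = m ^+ k *: c.
  elim: k => [|k IHk]; first by rewrite !expr0 mul1mx scale1r.
  by rewrite exprSr -mulmxE -mulmxA zc -scalemxAr IHk scalerA -exprS.
have := congr1 (mulmx^~ c) pz; rewrite mul0mx !mulmxDl -!scalemxAl !zX zc mul1mx.
rewrite !scalerA -{5}[c]scale1r -!scalerDl => /eqP; rewrite scaler_eq0 (negPf c0) orbF.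
by move/eqP.
Qed.

(** * Matrix identities over the field with its twisting automorphism *)

Section SuzukiField.
Variables (F : finFieldType) (n : nat).
Hypothesis cardF : #|F| = sz_q n.

Local Notation th := (@sz_theta F n).
Implicit Types a b c d l x y : F.

Lemma sz_pchar : 2 \in [pchar F].
Proof. exact: card_finPcharP cardF _. Qed.

Lemma natr_odd k : (k%:R : F) = (odd k)%:R.
Proof.
by rewrite -{1}(odd_double_half k) natrD -mul2n natrM (pcharf0 sz_pchar) mul0r addr0.
Qed.

Let n2 : (2 : F) = 0. Proof. exact: natr_odd 2. Qed.
Let n3 : (3 : F) = 1. Proof. exact: natr_odd 3. Qed.
Let n4 : (4 : F) = 0. Proof. exact: natr_odd 4. Qed.
Let n5 : (5 : F) = 1. Proof. exact: natr_odd 5. Qed.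
Let n6 : (6 : F) = 0. Proof. exact: natr_odd 6. Qed.
Let nm1 : (-1 : F) = 1. Proof. by rewrite (oppr_pchar2 sz_pchar). Qed.
Let nm2 : (-2 : F) = 0. Proof. by rewrite n2 oppr0. Qed.
Let nm3 : (-3 : F) = 1. Proof. by rewrite n3 nm1. Qed.

Ltac ring2 := ring: n2 n3 n4 n5 n6 nm1 nm2 nm3.
Ltac field2 := field: n2 n3 n4 n5 n6 nm1 nm2 nm3.

Lemma thD x y : th (x + y) = th x + th y.
Proof.
apply: exprDn_pchar; apply/andP; split; first by rewrite expn_gt0.
by apply/allP => p /[!primesX] //; rewrite primes_prime // inE => /eqP->; exact: sz_pchar.
Qed.

Lemma thM x y : th (x * y) = th x * th y. Proof. exact: exprMn. Qed.
Lemma thV x : th x^-1 = (th x)^-1. Proof. by rewrite /sz_theta exprVn. Qed.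
Lemma th0 : th 0 = 0. Proof. by rewrite /sz_theta expr0n expn_eq0. Qed.
Lemma th1 : th 1 = 1. Proof. exact: expr1n. Qed.
Lemma th_eq0 x : (th x == 0) = (x == 0).
Proof. by rewrite /sz_theta expf_eq0 expn_gt0. Qed.

(** The exponent [2 ^ n.+1] squared is [2 * q], and [x ^+ q = x]: [th] is a square root of the
    Frobenius map. *)
Lemma thK x : th (th x) = x ^+ 2.
Proof.
rewrite /sz_theta -exprM -expnD; have -> : (n.+1 + n.+1 = (2 * n + 1) + 1)%N by lia.
by rewrite expnD exprM -/(sz_q n) -cardF expf_card.
Qed.

Lemma th_fixed x : x != 0 -> th x = x -> x = 1.
Proof.
by move=> x0 xx; have := thK x; rewrite !xx expr2 -{1}[x]mulr1 => /(mulfI x0).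
Qed.

Definition sz_f a b := a ^+ 2 * th a + a * b + th b.
Definition sz_g a b := a * th a + b.

(** For [a != 0] the substitution [b = c * (a * th a)] leaves the factor [1 + c + th c]. If
    [th c = 1 + c], applying [th] gives [c ^+ 2 = c], so [c] is 0 or 1 and [th c = c], a
    contradiction. *)
Lemma sz_f_eq0 a b : (sz_f a b == 0) = (a == 0) && (b == 0).
Proof.
apply/idP/andP => [|[/eqP-> /eqP->]]; last by rewrite /sz_f th0 expr0n !mul0r !add0r.
have [->|a0] := eqVneq a 0.
  by rewrite /sz_f expr0n !mul0r !add0r th_eq0.
have ta0 : th a != 0 by rewrite th_eq0.
have [c bE] : exists c, b = c * (a * th a).
  by exists (b / (a * th a)); rewrite divfK // mulf_neq0.
have -> : sz_f a b = (a ^+ 2 * th a) * (1 + c + th c).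
  rewrite /sz_f bE !thM thK; ring.
have nz : a ^+ 2 * th a != 0 by rewrite mulf_neq0 ?expf_neq0.
rewrite mulf_eq0 (negPf nz) => /eqP c1; exfalso.
have tc : th c = 1 + c by rewrite -[LHS]addr0 -c1; ring2.
have := thK c; rewrite tc thD th1 tc => c2.
have cc : c = c ^+ 2 by rewrite -c2; ring2.
have : th c = c.
  have /eqP := cc; rewrite -subr_eq0 expr2 -{1}[c]mulr1 -mulrBr mulf_eq0.
  by case/orP=> [/eqP->|/eqP /subr0_eq <-]; rewrite ?th0 ?th1.
by rewrite tc -[X in _ = X]add0r => /addIr /eqP; rewrite oner_eq0.
Qed.

(** With [nat] indices the entries of concrete products reduce by computation. *)
Definition mx4 (f : nat -> nat -> F) : 'M[F]_4 := \matrix_(i, j) f i j.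

Lemma mx4_eq (f g : nat -> nat -> F) :
  (forall i j, (i < 4)%N -> (j < 4)%N -> f i j = g i j) -> mx4 f = mx4 g.
Proof. by move=> fg; apply/matrixP => i j; rewrite !mxE fg. Qed.

Lemma mx4_mul (f g : nat -> nat -> F) :
  mx4 f * mx4 g =
  mx4 (fun i j => f i 0%N * g 0%N j + f i 1%N * g 1%N j
                 + f i 2%N * g 2%N j + f i 3%N * g 3%N j).
Proof.
apply/matrixP => i j; rewrite !mxE !big_ord_recl big_ord0 !mxE /=.
by rewrite addr0 !addrA.
Qed.

Lemma mx4_1 : 1 = mx4 (fun i j => (i == j)%:R).
Proof. by apply/matrixP => i j; rewrite !mxE. Qed.

Definition T4 a b (i j : nat) : F :=
  match i, j return F with
  | 0, 0 => 1 | 1, 1 => 1 | 2, 2 => 1 | 3, 3 => 1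
  | 1, 0 => a | 2, 0 => b | 2, 1 => th a
  | 3, 0 => sz_f a b | 3, 1 => sz_g a b | 3, 2 => a
  | _, _ => 0
  end.
Definition M4 l (i j : nat) : F :=
  if i == j then match i with
    | 0 => l * l ^+ (2 ^ n) | 1 => l ^+ (2 ^ n) | 2 => (l ^+ (2 ^ n))^-1
    | _ => (l * l ^+ (2 ^ n))^-1 end else 0.
Definition W4 (i j : nat) : F := (i + j == 3)%N%:R.

Lemma sz_TE a b : sz_T n a b = mx4 (T4 a b). Proof. by []. Qed.

Lemma sz_ME l : sz_M n l = mx4 (M4 l).
Proof.
apply/matrixP => i j; rewrite !mxE /M4 (inj_eq val_inj); case: ifP => // _.
by case: i => -[|[|[|i]]] /=; rewrite ?exprD ?expr1.
Qed.

Lemma sz_WE : sz_W F = mx4 W4.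
Proof. by apply/matrixP => i j; rewrite !mxE /W4; case: ifP. Qed.

Ltac mx4_entries :=
  apply: mx4_eq => -[|[|[|[|//]]]] [|[|[|[|//]]]] _ _;
  rewrite /T4 /M4 /W4 /= ?mulr0 ?mul0r ?addr0 ?add0r ?mul1r ?mulr1.

Lemma sz_T_mul a b c d : sz_T n a b * sz_T n c d = sz_T n (a + c) (b + d + th a * c).
Proof.
rewrite !sz_TE mx4_mul; mx4_entries => //; rewrite /sz_f /sz_g ?thD ?thM ?thK; ring2.
Qed.

Lemma sz_T0 : sz_T n 0 0 = 1 :> 'M[F]_4.
Proof.
rewrite sz_TE mx4_1; mx4_entries => //.
all: by rewrite /sz_f /sz_g ?th0 ?mulr0 ?addr0 ?expr0n ?mul0r.
Qed.

Lemma sz_W_mul : sz_W F * sz_W F = 1.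
Proof. by rewrite sz_WE mx4_mul mx4_1; mx4_entries. Qed.

Lemma sz_M_mul l m : sz_M n l * sz_M n m = sz_M n (l * m).
Proof.
rewrite !sz_ME mx4_mul; mx4_entries => //; rewrite exprMn ?invfM; ring.
Qed.

Lemma sz_M1 : sz_M n 1 = 1 :> 'M[F]_4.
Proof. by rewrite sz_ME mx4_1; mx4_entries; rewrite ?expr1n ?mul1r ?invr1. Qed.

Lemma sz_W_M l : l != 0 -> sz_W F * sz_M n l = sz_M n l^-1 * sz_W F.
Proof.
by move=> l0; rewrite !sz_ME sz_WE !mx4_mul; mx4_entries; rewrite ?exprVn -?invfM ?invrK.
Qed.

Lemma sz_thE l : th l = (l ^+ (2 ^ n)) ^+ 2.
Proof. by rewrite /sz_theta expnS mulnC exprM. Qed.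

Lemma sz_T_M a b l : l != 0 ->
  sz_T n a b * sz_M n l = sz_M n l * sz_T n (l * a) (l * th l * b).
Proof.
move=> l0; rewrite !sz_TE !sz_ME !mx4_mul /sz_f /sz_g.
have L0 : l ^+ (2 ^ n) != 0 by rewrite expf_neq0.
mx4_entries => //; rewrite /sz_f /sz_g ?thM ?thK ?(sz_thE l);
  move: (l ^+ (2 ^ n)) L0 => L L0; by field; rewrite ?l0 ?L0.
Qed.

Lemma th_f a b : th (sz_f a b) = th a ^+ 2 * a ^+ 2 + th a * th b + b ^+ 2.
Proof. by rewrite /sz_f !thD !thM !thK; ring. Qed.

Lemma th_g a b : th (sz_g a b) = th a * a ^+ 2 + th b.
Proof. by rewrite /sz_g thD thM thK. Qed.

(** The exponents satisfy [2 * 2 ^ n = 2 ^ n.+1] and [2 ^ n.+1 * 2 ^ n = q]. *)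
Lemma sz_pow_f a b (l := sz_f a b ^+ 2 / th (sz_f a b)) : sz_f a b != 0 ->
  l ^+ (2 ^ n) = th (sz_f a b) / sz_f a b.
Proof.
rewrite /l; move: (sz_f a b) => y y0; rewrite exprMn exprVn; congr (_ * _^-1).
  by rewrite /sz_theta -exprM -expnS.
rewrite /sz_theta -exprM -expnD; have -> : (n.+1 + n = 2 * n + 1)%N by lia.
by rewrite -/(sz_q n) -cardF expf_card.
Qed.

(* The Bruhat relation: [W] maps the point [(f : g : a : 1)] of the Suzuki-Tits
   ovoid to [(1 : a : g : f)], with affine coordinates [g / f] and [a / f]. *)
Lemma sz_bruhat a b (f := sz_f a b) (g := sz_g a b) : f != 0 ->
  sz_W F * sz_T n a b * sz_W F * sz_T n (g / f) (a / f) =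
  sz_T n (b / f) (a / f) * sz_M n (f ^+ 2 / th f) * sz_W F.
Proof.
move=> f0; have tf0 : th f != 0 by rewrite th_eq0.
rewrite !sz_TE !sz_ME sz_WE !mx4_mul.
have BE : th b = f + a ^+ 2 * th a + a * b by rewrite /f /sz_f; ring2.
have tfE : th f = th a * f + th a * a * b + b ^+ 2 by rewrite /f th_f BE -/f; ring2.
have tgE : th g = f + a * b by rewrite /g th_g BE; ring2.
have gE : g = a * th a + b by [].
have Af : th a * f + th a * a * b + b ^+ 2 != 0 by rewrite -tfE.
have fg : sz_f (g / f) (a / f) = f^-1.
  rewrite /sz_f !thM !thV tgE tfE gE; move: (th a) Af => A.
  by move: f f0 {BE tfE tgE tf0} => t t0 tt; field2; rewrite ?t0 ?tt.
have fb : sz_f (b / f) (a / f) = f^-1.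
  rewrite /sz_f !thM !thV BE tfE; move: (th a) Af => A.
  by move: f f0 {BE tfE tgE tf0 fg} => t t0 tt; field2; rewrite ?t0 ?tt.
mx4_entries => //;
  rewrite ?fg ?fb -?/f -?/g ?sz_pow_f -?/f // /sz_g ?(thM g) ?(thM b) ?thV ?tgE ?tfE ?BE ?gE.
all: move: f f0 Af {fg fb BE tfE tgE tf0} => t t0; move: (th a) => A tt.
all: by field2; rewrite ?t0 ?tt.
Qed.

Lemma mx4_add f g : mx4 f + mx4 g = mx4 (fun i j => f i j + g i j).
Proof. by apply/matrixP => i j; rewrite !mxE. Qed.

Lemma mx4_scale c f : c *: mx4 f = mx4 (fun i j => c * f i j).
Proof. by apply/matrixP => i j; rewrite !mxE. Qed.

Lemma sz_g_inv a b : sz_g a (sz_g a b) = b.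
Proof. by rewrite /sz_g; ring2. Qed.

Lemma sz_f_inv a b : sz_f a (sz_g a b) = sz_f a b.
Proof. by rewrite /sz_f th_g /sz_g; ring2. Qed.

(** The trace of [sz_T n a b * sz_W F], that is, the antidiagonal sum of [sz_T n a b]. *)
Definition sz_tr a b := th a + sz_f a b.

Lemma sz_TW_inv a b :
  (sz_T n a b * sz_W F) * (sz_W F * sz_T n a (sz_g a b)) = 1.
Proof.
rewrite mulrA -[_ * _ * sz_W F]mulrA sz_W_mul mulr1 sz_T_mul -sz_T0.
by congr sz_T; rewrite /sz_g; ring2.
Qed.

Lemma sz_TW_poly a b (z := sz_T n a b * sz_W F) (s := sz_tr a b) :
  z ^+ 4 + s *: z ^+ 3 + th s *: z ^+ 2 + s *: z + 1 = 0.
Proof.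
set zi := sz_W F * sz_T n a (sz_g a b).
have zzi : z * zi = 1 by apply: sz_TW_inv.
(* The quartic is palindromic: dividing by [z ^+ 2] leaves only squares of [z] and of its explicit
   inverse to multiply out. *)
suff e : z * z + s *: z + th s *: 1 + s *: zi + zi * zi = 0.
  have -> : z ^+ 4 + s *: z ^+ 3 + th s *: z ^+ 2 + s *: z + 1 =
            z * z * (z * z + s *: z + th s *: 1 + s *: zi + zi * zi).
    rewrite !mulrDr -!scalerAr mulr1 -[z * z * zi]mulrA zzi mulr1.
    by rewrite [z * z * (zi * zi)]mulrA -[z * z * zi]mulrA zzi mulr1 zzi !exprS expr0 mulr1 !mulrA.
  by rewrite e mulr0.
rewrite /z /zi /s !sz_TE sz_WE mx4_1 !(mx4_mul, mx4_add, mx4_scale).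
transitivity (mx4 (fun _ _ => 0)); last by apply/matrixP => i j; rewrite !mxE.
mx4_entries.
all: rewrite ?sz_f_inv ?sz_g_inv /sz_tr /sz_f /sz_g ?thD ?thM ?thK; ring2.
Qed.
Section Normal.
Variables (a b : F).
Let z := sz_T n a b * sz_W F.
Let s := sz_tr a b.

(** At the eigenvalue 1 the outer terms cancel in pairs and leave [th s = 0], so the quartic is
    [X^4 + 1]. *)
Lemma sz_TW_unipotent (c : 'cV[F]_4) : c != 0 -> z *m c = c -> z ^+ 4 = 1.
Proof.
move=> c0 zc.
have pz : z ^+ 4 + s *: z ^+ 3 + th s *: z ^+ 2 + s *: z + 1 = 0 := sz_TW_poly a b.
have := poly_eigen (m := 1) pz c0; rewrite scale1r => /(_ zc).
rewrite !expr1n !mulr1 -/s => e.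
have /eqP : sz_theta n s = 0 by rewrite -e; ring2.
rewrite th_eq0 => /eqP s0; move: pz; rewrite s0 th0 !scale0r !addr0.
by move/eqP; rewrite addr_eq0 => /eqP ->; rewrite -scaleN1r nm1 scale1r.
Qed.

Definition col4 (x0 x1 x2 x3 : F) : 'cV[F]_4 := \col_i nth 0 [:: x0; x1; x2; x3] i.

Lemma col4E (c : 'cV[F]_4) : exists x0 x1 x2 x3, c = col4 x0 x1 x2 x3.
Proof.
exists (c (inord 0) ord0), (c (inord 1) ord0), (c (inord 2) ord0), (c (inord 3) ord0).
apply/matrixP => i j; rewrite !mxE ord1.
by case: i => -[|[|[|[|//]]]] lt_i /=; congr (c _ _); apply: val_inj; rewrite /= inordK.
Qed.

Lemma sz_TW_col x0 x1 x2 x3 : z *m col4 x0 x1 x2 x3 =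
  col4 x3 (x2 + a * x3) (x1 + sz_theta n a * x2 + b * x3)
       (x0 + a * x1 + sz_g a b * x2 + sz_f a b * x3).
Proof.
rewrite /z sz_TE sz_WE mx4_mul; apply/matrixP => i j.
rewrite !mxE !big_ord_recl big_ord0 !mxE /=.
by case: i => -[|[|[|[|//]]]] lt_i; rewrite /T4 /W4 /=; ring.
Qed.

(* If the first basis vector does not generate the module, then the common
   kernel of the row vectors [e_0 z^i] is a line stable under [z]. *)
Lemma sz_TW_cyclic (v : 'rV[F]_4 := delta_mx ord0 ord0) :
  (a, b) != (0, 0) ->
  \matrix_(i < 4) (v *m z ^+ i) \notin unitmx ->
  exists2 c : 'cV[F]_4, c != 0 & exists m, z *m c = m *: c.
Proof.
move=> ab; rewrite -unitmx_tr unitmxE unitfE negbK => /det0P[u u0 uK].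
exists u^T; first by rewrite trmx_eq0.
have {uK} uK i : (i < 4)%N -> v *m (z ^+ i *m u^T) = 0.
  move=> i4; rewrite mulmxA; have := congr1 trmx uK.
  rewrite trmx_mul trmxK trmx0 => /(congr1 (row (Ordinal i4))).
  by rewrite row_mul rowK row0.
have {u0} : u^T != 0 by rewrite trmx_eq0.
case: (col4E u^T) uK => x0 [x1 [x2 [x3 ->]]] uK c0.
have v0 y0 y1 y2 y3 : v *m col4 y0 y1 y2 y3 = 0 -> y0 = 0.
  move/matrixP/(_ ord0 ord0); rewrite !mxE !big_ord_recl big_ord0 !mxE /=.
  by rewrite mul1r !mul0r !addr0.
have zS k (c : 'cV[F]_4) : z ^+ k.+1 *m c = z *m (z ^+ k *m c).
  by rewrite exprS -mulmxE mulmxA.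
have := uK 0%N isT; rewrite expr0 mul1mx => /v0 e0.
have := uK 1%N isT; rewrite zS expr0 mul1mx sz_TW_col => /v0 e3.
have := uK 2%N isT; rewrite !zS expr0 mul1mx !sz_TW_col => /v0 e.
have := uK 3%N isT; rewrite !zS expr0 mul1mx !sz_TW_col => /v0.
rewrite {x0 uK}e0 {x3}e3 !mulr0 !addr0 add0r in c0 e *.
rewrite e mulr0 !addr0 add0r => e'.
set A := sz_theta n a in e' *; set g := sz_g a b in e e'.
have nz : (a != 0) || (g != 0).
  rewrite -negb_and; apply: contra ab => /andP[/eqP a0]; rewrite /g /sz_g a0 mul0r add0r.
  by move=> /eqP->.
(* The two equations are linear in the nonzero pair [(a, g)], and this is their determinant in
   characteristic 2. *)
have par : x1 ^+ 2 + A * x1 * x2 + x2 ^+ 2 = 0.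
  apply/eqP; case/orP: nz => nz; rewrite -(mulrI_eq0 _ (mulfI nz)); apply/eqP.
    have -> : a * (x1 ^+ 2 + A * x1 * x2 + x2 ^+ 2) =
      (a * x1 + g * x2) * (x1 + A * x2) + (a * x2 + g * (x1 + A * x2)) * x2 by ring2.
    by rewrite e e' !mul0r addr0.
  have -> : g * (x1 ^+ 2 + A * x1 * x2 + x2 ^+ 2) =
    (a * x1 + g * x2) * x2 + (a * x2 + g * (x1 + A * x2)) * x1 by ring2.
  by rewrite e e' !mul0r addr0.
have x20 : x2 != 0.
  apply: contraNneq c0 => x20; move: par; rewrite x20 mulr0 expr0n !addr0.
  move/eqP; rewrite expf_eq0 /= => /eqP ->; apply/eqP/matrixP => i j; rewrite !mxE.
  by case: i => -[|[|[|[|//]]]] lt_i.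
exists ((x1 + A * x2) / x2); apply/matrixP => i j; rewrite !mxE.
case: i => -[|[|[|[|//]]]] lt_i /=; rewrite ?mulr0 //; last by rewrite divfK.
have -> : (x1 + A * x2) / x2 * x1 = (x1 ^+ 2 + A * x1 * x2 + x2 ^+ 2) / x2 + x2.
  by field2.
by rewrite par mul0r add0r.
Qed.
End Normal.
End SuzukiField.

(** * The Borel subgroup and the Bruhat cells *)

Section SuzukiGroup.
Variables (F : finFieldType) (n : nat).
Hypotheses (n_gt0 : (0 < n)%N) (cardF : #|F| = sz_q n).
Local Notation q := (sz_q n).
Local Notation gl := {'GL_4[F]}.
Local Notation th := (@sz_theta F n).

Definition glT (a b : F) : gl := locked (insubd (1%g : gl) (sz_T n a b)).
Definition glM (l : F) : gl := locked (insubd (1%g : gl) (sz_M n l)).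
Definition glW : gl := locked (insubd (1%g : gl) (sz_W F)).

Lemma unit_of_mul (x y : 'M[F]_4) : x * y = 1 -> x \is a GRing.unit.
Proof. by move=> xy; have [] := mulmx1_unit (xy : x *m y = 1%:M). Qed.

Lemma val_glT a b : GLval (glT a b) = sz_T n a b.
Proof.
rewrite /glT -lock; apply: insubdK; apply: (@unit_of_mul _ (sz_T n a (b + th a * a))).
rewrite (sz_T_mul cardF) -(sz_T0 F n); congr sz_T.
  exact: (addrr_pchar2 (sz_pchar cardF)).
by rewrite addrA (addrr_pchar2 (sz_pchar cardF)) add0r (addrr_pchar2 (sz_pchar cardF)).
Qed.

Lemma val_glM l : l != 0 -> GLval (glM l) = sz_M n l.
Proof.
move=> l0; rewrite /glM -lock; apply: insubdK; apply: (@unit_of_mul _ (sz_M n l^-1)).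
by rewrite sz_M_mul divff // sz_M1.
Qed.

Lemma val_glW : GLval glW = sz_W F.
Proof. by rewrite /glW -lock; apply: insubdK; apply: (unit_of_mul (sz_W_mul F)). Qed.

Lemma gl_inj : injective (@GLval 4 F). Proof. exact: val_inj. Qed.

Lemma glT_mul a b c d : (glT a b * glT c d)%g = glT (a + c) (b + d + th a * c).
Proof. by apply: gl_inj; rewrite GL_ME !val_glT sz_T_mul. Qed.

Lemma glT0 : glT 0 0 = 1%g.
Proof. by apply: gl_inj; rewrite val_glT sz_T0. Qed.

Lemma glM_mul l m : l != 0 -> m != 0 -> (glM l * glM m)%g = glM (l * m).
Proof.
by move=> l0 m0; apply: gl_inj; rewrite GL_ME !val_glM ?mulf_neq0 // sz_M_mul.
Qed.

Lemma glM1 : glM 1 = 1%g.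
Proof. by apply: gl_inj; rewrite val_glM ?oner_neq0 // sz_M1. Qed.

Lemma glM_inv l : l != 0 -> (glM l)^-1%g = glM l^-1.
Proof.
move=> l0; apply: (mulgI (glM l)).
by rewrite mulgV glM_mul ?invr_neq0 // divff // glM1.
Qed.

Lemma glW_mul : (glW * glW)%g = 1%g.
Proof. by apply: gl_inj; rewrite GL_ME val_glW sz_W_mul. Qed.

Lemma glW_inv : (glW^-1)%g = glW.
Proof. by apply: (mulgI glW); rewrite mulgV glW_mul. Qed.

Lemma glT_M a b l : l != 0 ->
  (glT a b * glM l)%g = (glM l * glT (l * a)%R (l * th l * b)%R)%g.
Proof.
by move=> l0; apply: gl_inj; rewrite !GL_ME !val_glT !val_glM // (sz_T_M cardF).
Qed.

Lemma glW_M l : l != 0 -> (glW * glM l)%g = (glM (l^-1)%R * glW)%g.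
Proof.
move=> l0; apply: gl_inj; rewrite !GL_ME val_glW !val_glM ?invr_neq0 //.
exact: sz_W_M.
Qed.

Lemma glT_bruhat a b : glT a b != 1%g -> exists a1 b1 l a2 b2,
  l != 0 /\ (glW * glT a b * glW)%g = (glT a1 b1 * glM l * glW * glT a2 b2)%g.
Proof.
move=> ab; pose f := sz_f n a b; pose g := sz_g n a b.
have f0 : f != 0.
  apply: contra ab => /eqP/eqP; rewrite (sz_f_eq0 cardF) => /andP[/eqP-> /eqP->].
  by rewrite glT0.
have l0 : f ^+ 2 / th f != 0 by rewrite mulf_neq0 ?invr_neq0 ?th_eq0 // expf_neq0.
have invT c d : exists c' d', (glT c d)^-1%g = glT c' d'.
  exists c, (d + th c * c); apply: (mulgI (glT c d)); rewrite mulgV glT_mul -glT0.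
  rewrite addrA !(addrr_pchar2 (sz_pchar cardF)) add0r.
  by rewrite (addrr_pchar2 (sz_pchar cardF)).
have [a2 [b2 e2]] := invT (g / f) (a / f).
exists (b / f), (a / f), (f ^+ 2 / th f), a2, b2; split=> //.
apply: (mulIg (glT (g / f) (a / f))); rewrite -e2 mulgKV.
apply: gl_inj; rewrite !GL_ME !val_glT !val_glW val_glM //.
exact: (sz_bruhat cardF f0).
Qed.

Definition szU : {set gl} := [set glT p.1 p.2 | p : F * F].
Definition szH : {set gl} := [set glM l | l in [set l : F | l != 0]].

Lemma szUP x : reflect (exists a b, x = glT a b) (x \in szU).
Proof.
apply: (iffP imsetP) => [[[a b] _ ->]|[a [b ->]]]; first by exists a, b.
by exists (a, b).
Qed.

Lemma szHP x : reflect (exists2 l, l != 0 & x = glM l) (x \in szH).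
Proof.
apply: (iffP imsetP) => [[l + ->]|[l l0 ->]]; first by rewrite inE; exists l.
by exists l; rewrite ?inE.
Qed.

Lemma szU_group_set : group_set szU.
Proof.
apply/group_setP; split; first by apply/szUP; exists 0, 0; rewrite glT0.
move=> x y /szUP[a [b ->]] /szUP[c [d ->]]; apply/szUP.
by exists (a + c), (b + d + th a * c); rewrite glT_mul.
Qed.
Canonical szU_group := Group szU_group_set.

Lemma szH_group_set : group_set szH.
Proof.
apply/group_setP; split; first by apply/szHP; exists 1; rewrite ?oner_neq0 ?glM1.
move=> x y /szHP[l l0 ->] /szHP[m m0 ->]; apply/szHP.
by exists (l * m); rewrite ?mulf_neq0 ?glM_mul.
Qed.
Canonical szH_group := Group szH_group_set.

Lemma GLval_T_entries a b : (GLval (glT a b) (inord 1) ord0 = a) *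
  (GLval (glT a b) (inord 2) ord0 = b).
Proof. by rewrite !val_glT !mxE /= !inordK. Qed.

Lemma glT_inj a b c d : glT a b = glT c d -> a = c /\ b = d.
Proof.
move=> e; split; first by rewrite -(GLval_T_entries a b).1 e GLval_T_entries.
by rewrite -(GLval_T_entries a b).2 e GLval_T_entries.
Qed.

Lemma glM_inj l m : l != 0 -> m != 0 -> glM l = glM m -> l = m.
Proof.
move=> l0 m0 e.
have e1 : l ^+ (2 ^ n) = m ^+ (2 ^ n).
  have := congr1 (fun x : gl => GLval x (inord 1) (inord 1)) e.
  by rewrite !val_glM // !mxE eqxx inordK.
have := congr1 (fun x : gl => GLval x ord0 ord0) e.
rewrite !val_glM // !mxE eqxx /= !exprD !expr1 e1 => /mulIf; apply.
by rewrite expf_neq0.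
Qed.

Lemma card_szU : #|szU| = (q ^ 2)%N.
Proof.
rewrite card_imset ?cardX; first by rewrite card_prod !cardF.
by move=> [a b] [c d] /= /glT_inj[-> ->].
Qed.

Lemma card_szH : #|szH| = (q - 1)%N.
Proof.
rewrite card_in_imset; last by move=> l m; rewrite !inE; apply: glM_inj.
by rewrite -cardF subn1 -(cardsC1 (0 : F)); apply: eq_card => l; rewrite !inE.
Qed.

Lemma glT_conj a b l : l != 0 ->
  (glT a b ^ glM l)%g = glT (l * a)%R (l * th l * b)%R.
Proof. by move=> l0; rewrite conjgE glT_M // mulKg. Qed.

Lemma glM_conjW l : l != 0 -> (glM l ^ glW)%g = (glM l)^-1%g.
Proof.
by move=> l0; rewrite conjgE glW_inv mulgA glW_M // -mulgA glW_mul mulg1 glM_inv.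
Qed.

Lemma szH_norm_szU : szH \subset 'N(szU)%g.
Proof.
apply/subsetP => x /szHP[l l0 ->]; rewrite inE; apply/subsetP => y /imsetP[z].
by case/szUP=> a [b ->] ->; rewrite glT_conj //; apply/szUP; eexists; eexists.
Qed.

(** A fixed point with [b != 0] needs [th l = l^-1]; applying [th] gives [l ^+ 2 = l]. *)
Lemma szH_semiregular a b l : l != 0 -> l != 1 -> (glT a b ^ glM l)%g = glT a b ->
  a = 0 /\ b = 0.
Proof.
move=> l0 l1; rewrite glT_conj // => /glT_inj[ea eb].
have fixed x (k : F) : k != 1 -> k * x = x -> x = 0.
  move=> k1 /eqP; rewrite -subr_eq0 -{2}[x]mul1r -mulrBl mulf_eq0 subr_eq0.
  by rewrite (negPf k1) => /eqP.
split; first exact: fixed ea; apply: fixed eb; apply: contra l1 => /eqP ll.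
have tl : th l = l^-1 by apply: (mulfI l0); rewrite ll divff.
have := thK cardF l; rewrite tl thV tl invrK expr2 -{1}[l]mulr1 => /(mulfI l0) <-.
exact: eqxx.
Qed.

Lemma szU_szH_trivial : (szU :&: szH)%g = 1%g.
Proof.
apply/trivgP/subsetP => x /setIP[/szUP[a [b ->]] /szHP[l l0 e]].
have := congr1 (fun x : gl => GLval x (inord 1) ord0) e.
have := congr1 (fun x : gl => GLval x (inord 2) ord0) e.
rewrite !GLval_T_entries !val_glM // !mxE -!val_eqE /= !inordK //= => -> ->.
by rewrite glT0 group1.
Qed.

Definition szB := (szU_group <*> szH_group)%G.

Lemma szBP x : reflect (exists a b l, l != 0 /\ x = (glT a b * glM l)%g) (x \in szB).
Proof.
rewrite /= norm_joinEr ?szH_norm_szU //; apply: (iffP mulsgP).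
  by case=> u h /szUP[a [b ->]] /szHP[l l0 ->] ->; exists a, b, l.
case=> a [b [l [l0 ->]]]; exists (glT a b) (glM l) => //; last by apply/szHP; exists l.
by apply/szUP; exists a, b.
Qed.

Lemma sz_sdprod : (szU_group ><| szH_group)%g = szB.
Proof. by rewrite sdprodEY ?szH_norm_szU ?szU_szH_trivial. Qed.

Lemma sz_q_gt7 : (7 < q)%N.
Proof.
apply: (@leq_trans (2 ^ 3)%N) => //.
by rewrite leq_exp2l // addn1 ltnS leq_pmulr.
Qed.

Lemma sz_q_even : ~~ odd q.
Proof. by rewrite /sz_q oddX addn1. Qed.

Lemma sz_Frobenius : [Frobenius szB = szU_group ><| szH_group]%g.
Proof.
have q1 : (1 < q)%N := ltn_trans (isT : (1 < 7)%N) sz_q_gt7.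
apply/(Frobenius_semiregularP sz_sdprod).
- by rewrite -cardG_gt1 card_szU (ltn_exp2l 0).
- by rewrite -cardG_gt1 card_szH ltn_subRL (leq_trans _ sz_q_gt7).
move=> x /setD1P[x1 /szHP[l l0 xl]]; apply/trivgP/subsetP => y /setIP[/szUP[a [b ye]]].
move/cent1P=> xy; have l1 : l != 1 by apply: contraNneq x1 => l1; rewrite xl l1 glM1.
have yx : (glT a b ^ glM l)%g = glT a b.
  by subst x y; apply/conjg_fixP/commgP.
have [ea eb] := szH_semiregular l0 l1 yx.
by rewrite ye ea eb glT0 group1.
Qed.

Definition szG : {group gl} := (<<[set x : gl | sz_gen n (GLval x)]>>)%G.

Lemma Suzuki_szG : Suzuki F n = szG. Proof. by []. Qed.

Lemma glT_szG a b : glT a b \in szG.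
Proof.
apply: mem_gen; rewrite inE val_glT; apply/orP; left; apply/existsP; exists a.
by apply/existsP; exists b.
Qed.

Lemma glM_szG l : l != 0 -> glM l \in szG.
Proof.
move=> l0; apply: mem_gen; rewrite inE val_glM //; apply/orP; right; apply/orP; left.
by apply/existsP; exists l; rewrite l0 eqxx.
Qed.

Lemma glW_szG : glW \in szG.
Proof. by apply: mem_gen; rewrite inE val_glW; apply/or3P; constructor 3. Qed.

Lemma szB_sub_szG : szB \subset szG.
Proof.
rewrite join_subG; apply/andP; split; apply/subsetP => x.
  by case/szUP=> a [b ->]; apply: glT_szG.
by case/szHP=> l l0 ->; apply: glM_szG.
Qed.

(** Conjugation by [W] makes lower triangular matrices upper triangular, so the entries of [x] below
    the diagonal vanish. *)
Lemma szB_inter_W : (szB :&: szB :^ glW)%g \subset szH.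
Proof.
apply/subsetP => x /setIP[/szBP[a [b [l [l0 xe]]]]].
rewrite mem_conjg glW_inv => /szBP[c [d [m [m0 xw]]]].
have xx : x = (glW * (glT c d * glM m) * glW)%g.
  by rewrite -xw conjgE glW_inv !mulgA glW_mul mul1g -mulgA glW_mul mulg1.
have L0 : l * l ^+ (2 ^ n) != 0 by rewrite mulf_neq0 ?expf_neq0.
have := congr1 (fun A : 'M[F]_4 => A (inord 2) ord0) (congr1 (@GLval 4 F) xx).
have := congr1 (fun A : 'M[F]_4 => A (inord 1) ord0) (congr1 (@GLval 4 F) xx).
rewrite xe !GL_ME !val_glT !val_glM // !val_glW !sz_TE !sz_ME sz_WE !mx4_mul.
rewrite !mxE !inordK // /T4 /M4 /W4 /= !(mulr0, mul0r, addr0, add0r, mulr1, mul1r).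
have cancel t : t * (l * l ^+ (2 ^ n)) = 0 -> t = 0.
  by move=> tl; apply: (mulIf L0); rewrite tl mul0r.
move=> /cancel a0 /cancel b0.
by rewrite a0 b0 glT0 mul1g; apply/szHP; exists l.
Qed.

Lemma sz_invHW : {in szH, forall h, h ^ glW = h^-1}%g.
Proof. by move=> h /szHP[l l0 ->]; apply: glM_conjW. Qed.

Lemma szH_abelian : abelian szH.
Proof.
apply/centsP => x /szHP[l l0 ->] y /szHP[m m0 ->].
by rewrite /commute !glM_mul // mulrC.
Qed.

(** The union of the two cells is stable under right multiplication by every generator. Elements of
    [H] pass through [W], and a product [W u W] is rewritten by [glT_bruhat]. *)
Lemma sz_bruhat_cells : {in szG, forall g, g \in szB \/
  exists b u, [/\ b \in szB, u \in szU & g = b * glW * u]%g}.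
Proof.
have sUB : szU \subset szB by apply: joing_subl.
have sHB : szH \subset szB by apply: joing_subr.
have nUH := szH_norm_szU.
have BM x y : x \in szB -> y \in szB -> (x * y)%g \in szB by apply: groupM.
move=> g /gen_prodgP[k [c cP ->]] {g}.
elim: k c cP => [|k IHk] c cP; first by left; rewrite big_ord0 group1.
rewrite big_ord_recr /=; set y := (\prod_(i < k) _)%g.
have {IHk} : y \in szB \/ exists b u, [/\ b \in szB, u \in szU & y = b * glW * u]%g.
  by apply: IHk => i.
have := cP ord_max; move: (c ord_max) y => s y {c cP k}; rewrite inE.
case/or3P=> [/existsP[a /existsP[b /eqP es]]|/existsP[l /andP[l0 /eqP es]]|/eqP es].
- have Us : s \in szU by apply/szUP; exists a, b; apply: gl_inj; rewrite val_glT.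
  case=> [By|[b' [u [Bb Uu ->]]]]; first by left; exact: BM By (subsetP sUB _ Us).
  by right; exists b', (u * s)%g; rewrite (groupM Uu Us) mulgA.
- have {es} es : s = glM l by apply: gl_inj; rewrite val_glM.
  have Hs : s \in szH by apply/szHP; exists l.
  case=> [By|[b' [u [Bb Uu ->]]]]; first by left; exact: BM By (subsetP sHB _ Hs).
  right; exists (b' * s^-1)%g, (u ^ s)%g; split.
  + by apply: BM Bb _; apply: (subsetP sHB); rewrite groupV.
  + by rewrite memJ_norm // (subsetP nUH).
  + rewrite -!mulgA; congr (_ * _)%g; rewrite conjgE [(s^-1 * (glW * _))%g]mulgA.
    rewrite [(s^-1 * glW)%g](_ : _ = glW * s)%g ?mulgA ?mulgK //.
    by rewrite es glM_inv // glW_M.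
have {es} -> : s = glW by apply: gl_inj; rewrite val_glW.
case=> [By|[b' [u [Bb Uu ->]]]].
  by right; exists y, 1%g; rewrite group1 mulg1.
have [->|u1] := eqVneq u 1%g; first by left; rewrite mulg1 -mulgA glW_mul mulg1.
case/szUP: Uu u1 => a [b ->] /glT_bruhat[a1 [b1 [l [a2 [b2 [l0 e]]]]]].
right; exists (b' * (glT a1 b1 * glM l))%g, (glT a2 b2); split.
- by apply: BM Bb _; apply/szBP; exists a1, b1, l.
- by apply/szUP; exists a2, b2.
- by rewrite -!mulgA; congr (_ * _)%g; rewrite !mulgA.
Qed.
End SuzukiGroup.

Lemma sz_torus_index q k : (1 < q)%N ->
  (2 * (q - 1) * k = q ^ 2 * (q - 1) * (q ^ 2 + 1))%N -> k = (q ^ 2 * (q ^ 2 + 1) %/ 2)%N.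
Proof.
move=> q1 e; have c0 : (0 < q - 1)%N by rewrite subn_gt0.
have -> : (q ^ 2 * (q ^ 2 + 1) = k * 2)%N; last by rewrite mulnK.
by apply/eqP; rewrite -(eqn_pmul2l c0); apply/eqP; move: e; move: (q - 1)%N; lia.
Qed.

Lemma sz_cyclic_index q k m m' : (0 < m)%N -> (m * m' = q ^ 2 + 1)%N ->
  (4 * m * k = q ^ 2 * (q - 1) * (q ^ 2 + 1))%N -> k = (q ^ 2 * (q - 1) * m' %/ 4)%N.
Proof.
move=> m0 <- e.
have -> : (q ^ 2 * (q - 1) * m' = k * 4)%N; last by rewrite mulnK.
by apply/eqP; rewrite -(eqn_pmul2l m0); apply/eqP; move: e; move: (q ^ 2 * (q - 1))%N; lia.
Qed.

Lemma not_dvd3_arith k (q := (3 * k + 2)%N) :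
  ~~ (3 %| q ^ 2 * (q - 1) * (q ^ 2 + 1))%N.
Proof.
have -> : (q - 1 = 3 * k + 1)%N by rewrite /q; lia.
have -> : (q ^ 2 = 3 * (3 * k ^ 2 + 4 * k + 1) + 1)%N by rewrite /q; lia.
move: (3 * k ^ 2 + 4 * k + 1)%N => m.
rewrite !Euclid_dvdM // !negb_or -andbA -[(3 * m + 1 + 1)%N]addnA.
by rewrite ![(3 %| 3 * _ + _)%N]dvdn_addr ?dvdn_mulr.
Qed.

(** * Regular elements of the Suzuki group and the final product *)

Section SuzukiTrees.
Variables (F : finFieldType) (n : nat).
Hypotheses (n_gt0 : (0 < n)%N) (cardF : #|F| = sz_q n).
Local Notation q := (sz_q n).
Local Notation gl := {'GL_4[F]}.
Local Notation th := (@sz_theta F n).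
Local Notation T := (@glT F n).
Local Notation M := (@glM F n).
Local Notation W := (glW F).
Local Notation U := (szU_group cardF).
Local Notation H := (szH_group F n).
Local Notation B := (szB cardF).
Local Notation G := (szG F n).
Local Notation R := (regular_set G U H).

Let bruhatG := sz_bruhat_cells cardF.
Let frobB := sz_Frobenius n_gt0 cardF.
Let sBG := szB_sub_szG cardF.
Let q7 := sz_q_gt7 n_gt0.
Let qE := sz_q_even n.
Let WG := glW_szG F n.
Let W2 := glW_mul F.
Let abH := szH_abelian F n.
Let invHW : {in H, forall h, h ^ W = h^-1}%g := @sz_invHW F n.
Let sBBW := szB_inter_W cardF.
Let cU : #|U| = (q ^ 2)%N := card_szU cardF.
Let cH : #|H| = (q - 1)%N := card_szH cardF.

Lemma szR_J : {in R & G, forall x g, (x ^ g)%g \in R}.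
Proof. exact: regular_setJ. Qed.

Lemma szR_cent : {in R, forall x, {in 'C_G[x]^#%g, forall y, y \in R}}.
Proof. exact: (regular_set_cent q7 qE frobB sBG W2 abH invHW sBBW bruhatG cH). Qed.

Lemma szR_coprime : {in R, forall x, coprime #[x]%g #|B|}.
Proof.
move=> x Rx.
exact: (regular_order_coprime q7 qE frobB sBG WG W2 abH invHW sBBW bruhatG cU cH Rx).
Qed.

Lemma card_szB : #|B| = (q ^ 2 * (q - 1))%N.
Proof. by rewrite -(sdprod_card (sz_sdprod cardF)) cU cH. Qed.

Lemma szR_expg x m : x \in R -> (m %| #|B|)%N -> (x ^+ m != 1)%g.
Proof.
exact: (regular_expg_neq1 q7 qE frobB sBG WG W2 abH invHW sBBW bruhatG cU cH).
Qed.

Lemma szR_normal_form z : z \in R ->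
  exists g a b, [/\ g \in G, (a, b) != (0, 0) & (z ^ g = T a b * W)%g].
Proof.
move=> Rz; have [u [b0 [Uu Bb zu]]] := regular_bruhat frobB sBG bruhatG Rz.
have [a [b [l [l0 b0E]]]] := szBP cardF _ Bb.
(* The square root of [l], the exponent being [q / 2]. *)
pose k := l ^+ (2 ^ (2 * n)).
have kk : k * k = l.
  by rewrite -expr2 -exprM -expnSr -[(2 * n).+1]addn1 -/(sz_q n) -cardF expf_card.
have k0 : k != 0 by apply: contraNneq l0 => k0; rewrite -kk k0 mul0r.
have sUG : u \in G by apply: (subsetP sBG); apply: (subsetP (joing_subl _ _)).
have zg : (z ^ (u * M k) = T (k * a)%R (k * th k * b)%R * W)%g.
  have WM : (W * M k = (M k)^-1 * W)%g by rewrite glW_M // glM_inv.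
  by rewrite conjgM zu b0E -kk -glM_mul // (conj_inverted _ WM) (glT_conj cardF).
exists (u * M k)%g, (k * a), (k * th k * b); split=> //.
  by apply: groupM; rewrite // glM_szG.
(* Otherwise a conjugate of [z] would be the involution [W], while 2 divides [#|B|]. *)
apply/eqP => -[ka kb]; have RzJ : (z ^ (u * M k))%g \in R.
  by apply: szR_J => //; apply: groupM; rewrite // glM_szG.
have B2 : (2 %| #|B|)%N by rewrite card_szB dvdn_mulr // dvdn_exp // dvdn2.
by have /eqP[] := szR_expg RzJ B2; rewrite zg ka kb glT0 // mul1g expgS expg1 W2.
Qed.

Lemma GLvalX (x : gl) k : GLval (x ^+ k)%g = GLval x ^+ k.
Proof. by elim: k => // k IHk; rewrite expgS exprS GL_ME IHk. Qed.

Lemma val_TW a b : GLval (T a b * W)%g = sz_T n a b * sz_W F.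
Proof. by rewrite GL_ME (val_glT cardF) val_glW. Qed.

Lemma GLval_conj_mul (z g : gl) (c : 'cV[F]_4) :
  GLval (z ^ g)%g *m (GLval g^-1%g *m c) = GLval g^-1%g *m (GLval z *m c).
Proof. by rewrite !mulmxA -!GL_MxE conjgE -!mulgA mulgV mulg1. Qed.

Lemma GLval_mulVg (g : gl) : GLval g^-1%g *m GLval g = 1%:M.
Proof. by rewrite -GL_MxE mulVg. Qed.

Lemma GLval_col_neq0 (g : gl) (c : 'cV[F]_4) : c != 0 -> GLval g *m c != 0.
Proof.
apply: contra => /eqP gc.
by rewrite -[c]mul1mx -(GLval_mulVg g) -mulmxA gc mulmx0.
Qed.

Lemma szR_no_fixed_vector z (c : 'cV[F]_4) : z \in R -> c != 0 -> GLval z *m c != c.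
Proof.
move=> Rz c0; apply/eqP => zc; have [g [a [b [Gg _ zg]]]] := szR_normal_form Rz.
have Rzg := szR_J Rz Gg.
have B4 : (4 %| #|B|)%N.
  by rewrite card_szB dvdn_mulr // (@dvdn_exp2r 2 _ 2) // dvdn2.
case/eqP: (szR_expg Rzg B4); apply: gl_inj; rewrite GLvalX zg val_TW.
apply: (sz_TW_unipotent cardF (GLval_col_neq0 g^-1%g c0)).
by rewrite -val_TW -zg GLval_conj_mul zc.
Qed.

Lemma szR_sub_unit y z : y \in G -> z \in G -> y != z -> (y^-1 * z)%g \in R ->
  GLval y - GLval z \is a GRing.unit.
Proof.
move=> Gy Gz yz Ryz; apply: contraT; rewrite -[_ \in _]/(_ \in unitmx) => nu.
move: nu; rewrite -unitmx_tr unitmxE unitfE negbK => /det0P[c c0].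
move/(congr1 trmx); rewrite trmx_mul trmxK trmx0 mulmxBl => /eqP; rewrite subr_eq0 => /eqP e.
have c0' : c^T != 0 by rewrite trmx_eq0.
have /eqP[] := szR_no_fixed_vector Ryz c0'.
by rewrite GL_MxE -mulmxA -e mulmxA GLval_mulVg mul1mx.
Qed.

(** Without a cyclic vector [z] would have an eigenvector with eigenvalue in [F]. The power [q - 1]
    of [z], still in [R], would then fix that vector. *)
Lemma szR_abelian : {in R, forall z, abelian 'C_G[z]%g}.
Proof.
move=> z Rz; have [g [a [b [Gg ab zg]]]] := szR_normal_form Rz.
have Rzg := szR_J Rz Gg; set z1 := (z ^ g)%g in zg Rzg.
have cyc : \matrix_(i < 4) (delta_mx ord0 ord0 *m (sz_T n a b * sz_W F) ^+ i) \in unitmx.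
  apply: contraT => /(sz_TW_cyclic cardF ab)[c c0 [m zc]].
  have m0 : m != 0.
    apply: contraNneq (GLval_col_neq0 z1 c0) => m0.
    by rewrite zg val_TW zc m0 scale0r.
  have zX k : GLval (z1 ^+ k)%g *m c = m ^+ k *: c.
    rewrite GLvalX zg val_TW; elim: k => [|k IHk]; first by rewrite !expr0 mul1mx scale1r.
    by rewrite exprSr -mulmxE -mulmxA zc -scalemxAr IHk scalerA -exprS.
  have qB : (q - 1 %| #|B|)%N by rewrite card_szB dvdn_mull.
  have Rz1 : (z1 ^+ (q - 1))%g \in R.
    apply: (szR_cent Rzg); rewrite in_setD1 (szR_expg Rzg qB) andTb.
    have /setDP[/setD1P[_ Gz1] _] := Rzg.
    by rewrite groupX // inE Gz1 cent1id.
  case/eqP: (szR_no_fixed_vector Rz1 c0); rewrite zX.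
  have -> : m ^+ (q - 1) = 1.
    apply: (mulfI m0); rewrite -exprS subn1 prednK ?(ltnW (ltnW q7)) //.
      by rewrite -cardF expf_card mulr1.
    by apply: leq_trans q7.
  by rewrite scale1r.
apply/centsP => x /setIP[_ /cent1P xz] y /setIP[_ /cent1P yz].
have conjz t : commute t z -> GLval (t ^ g)%g * (sz_T n a b * sz_W F) =
    (sz_T n a b * sz_W F) * GLval (t ^ g)%g.
  move=> tz; have tz1 : (t ^ g * z1 = z1 * t ^ g)%g by rewrite /z1 -!conjMg tz.
  by rewrite -val_TW -zg -!GL_ME tz1.
apply: (conjg_inj g); rewrite !conjMg; apply: gl_inj; rewrite !GL_ME.
exact: cyclic_centralizer cyc (conjz x xz) (conjz y yz).
Qed.

Lemma szR_conj_le4 : {in R, forall z, #|(z ^: G :&: 'C_G[z])%g| <= 4}%N.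
Proof.
move=> z Rz; have [g [a [b [Gg _ zg]]]] := szR_normal_form Rz.
pose s := sz_tr n a b; set D := (_ :&: _)%g.
pose p : {poly 'M[F]_4} := 'X^4 + ((s%:M)%:P * 'X^3 + ((th s)%:M%:P * 'X^2 +
                             ((s%:M)%:P * 'X + 1%:P))).
have szp : size p = 5%N.
  rewrite size_polyDl size_polyXn //.
  have sz_le (c : 'M[F]_4) k : (size (c%:P * 'X^k)%R <= k.+1)%N.
    by rewrite mul_polyC (leq_trans (size_scale_leq _ _)) ?size_polyXn.
  rewrite ltnS; apply: leq_trans (size_polyD _ _) _; rewrite geq_max sz_le /=.
  apply: leq_trans (size_polyD _ _) _; rewrite geq_max (leq_trans (sz_le _ _)) //=.
  apply: leq_trans (size_polyD _ _) _; rewrite geq_max -['X]/('X^1).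
  rewrite (leq_trans (sz_le _ _)) //= (leq_trans (size_polyC_leq1 _)) //.
have p0 : p != 0 by rewrite -size_poly_eq0 szp.
pose rs := [seq GLval y | y <- enum D].
have -> : #|D| = size rs by rewrite size_map -cardE.
(* The root bound over the matrix ring asks for pairwise commuting roots with invertible
   differences; these come from [szR_abelian] and [szR_sub_unit]. *)
rewrite -ltnS -szp; apply: (max_ring_poly_roots p0).
  apply/allP => _ /mapP[y + ->]; rewrite mem_enum => /setIP[/imsetP[h Gh ->] _].
  pose k := (g^-1 * h)%g; pose Z := sz_T n a b * sz_W F.
  have YX i : GLval (z ^ h)%g ^+ i = GLval k^-1%g * Z ^+ i * GLval k.
    rewrite -GLvalX /Z -val_TW -zg -GLvalX -!GL_ME -mulgA -conjgE -!conjXg.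
    by rewrite -conjgM mulKVg.
  have pZ : Z ^+ 4 + s *: Z ^+ 3 + th s *: Z ^+ 2 + s *: Z + 1 = 0 := sz_TW_poly cardF a b.
  apply/eqP; rewrite /p !hornerD hornerXn !hornerCM !hornerXn hornerX hornerC.
  rewrite -!mulmxE !mul_scalar_mx -[GLval (z ^ h)%g in X in _ + (_ + (_ + (X + _)))]expr1.
  rewrite -(expr0 (GLval (z ^ h)%g)) !YX !addrA.
  transitivity (GLval k^-1%g * (Z ^+ 4 + s *: Z ^+ 3 + th s *: Z ^+ 2 + s *: Z + 1) * GLval k).
    by rewrite !mulrDr !mulrDl -!scalerAr -!scalerAl expr1 expr0.
  by rewrite pZ mulr0 mul0r.
have Gz : z \in G by have /setDP[/setD1P[]] := Rz.
have /allP Ds : all (mem D) (enum D) by apply/allP => y; rewrite mem_enum.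
rewrite /rs; elim: (enum D) (enum_uniq D) Ds => //= y ys IHys /andP[yys uys] Dys.
apply/andP; split; last by apply: IHys => // t tys; apply: Dys; rewrite inE tys orbT.
apply/allP => _ /mapP[t tys ->].
have /setIP[_ Cy] : y \in D by apply: Dys; rewrite inE eqxx.
have /setIP[_ Ct] : t \in D by apply: Dys; rewrite inE tys orbT.
have ty : t != y by apply: contraNneq yys => <-.
apply/andP; split.
  have yt : (y * t = t * y)%g by exact: (centsP (szR_abelian Rz) y Cy t Ct).
  by apply/eqP; apply: (congr1 (@GLval 4 F) yt).
apply: szR_sub_unit => //; first by case/setIP: Ct.
  by case/setIP: Cy.
apply: (szR_cent Rz); rewrite in_setD1 groupM ?groupV // andbT.
by rewrite -eq_mulVg1.
Qed.

(** Commutation means [th a * c = th c * a]; for nonzero [a] and [c] the quotient [a / c] is then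
    fixed by [th], hence equal to 1. *)
Lemma glT_commute a b c d :
  (T a b * T c d == T c d * T a b)%g = [|| a == 0, c == 0 | a == c].
Proof.
rewrite !(glT_mul cardF).
transitivity (th a * c == th c * a).
  apply/eqP/eqP => [/(glT_inj cardF)[_]|e]; last by rewrite e [a + c]addrC [b + d]addrC.
  by rewrite [d + b]addrC => /addrI.
have [->|a0] := eqVneq a 0; first by rewrite th0 mul0r mulr0 eqxx.
have [->|c0] := eqVneq c 0; first by rewrite th0 mul0r mulr0 eqxx.
apply/eqP/eqP => [e|->] //=.
suff : a / c = 1 by move/(canRL (divfK c0)); rewrite mul1r.
apply: (th_fixed cardF); first by rewrite mulf_neq0 ?invr_eq0.
have tc0 : th c != 0 by rewrite th_eq0.
rewrite thM thV; apply: (mulIf tc0); rewrite divfK //.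
by apply: (mulIf c0); rewrite e mulrAC divfK // mulrC.
Qed.

Definition gl_coord (x : gl) : F := GLval x (inord 1) ord0.

Lemma gl_coord_T a b : gl_coord (T a b) = a.
Proof. by rewrite /gl_coord (GLval_T_entries cardF). Qed.

Lemma kappa_szU (g : gl) : kappa_C (U :^ g)%g = (2 ^ ((q - 1) ^ 2) * q ^ (q ^ 2 + q - 3))%N.
Proof.
pose phi (x : gl) := gl_coord (x ^ g^-1)%g.
have phiT a b : phi (T a b ^ g)%g = a.
  by rewrite /phi conjgK gl_coord_T.
have memU (x : gl) : reflect (exists a b, x = (T a b ^ g)%g) (x \in (U :^ g)%g).
  rewrite mem_conjg; apply: (iffP (szUP _ _)) => -[a [b e]]; exists a, b.
    by rewrite -e conjgKV.
  by rewrite e conjgK.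
apply: (@kappa_centered _ _ F 0 phi).
- exact: group1.
- by rewrite -(conj1g g) -(glT0 cardF) phiT.
- exact: cardF.
- move=> k; rewrite -cardF.
  have <- : #|[set (T k b ^ g)%g | b : F]| = #|F|.
    by rewrite card_imset // => b d /conjg_inj/(glT_inj cardF)[].
  apply: eq_card => x; rewrite inE; apply/andP/imsetP => [[/memU[a [b ->]]]|[b _ ->]].
    by rewrite phiT => /eqP->; exists b.
  by rewrite phiT; split=> //; apply/memU; exists k, b.
move=> _ _ /memU[a [b ->]] /memU[c [d ->]].
by rewrite -!conjMg (inj_eq (@conjg_inj _ g)) !phiT glT_commute.
Qed.

Lemma card_szG : #|G| = (q ^ 2 * (q - 1) * (q ^ 2 + 1))%N.
Proof. by rewrite (card_SplitRankOne frobB sBG WG W2 sBBW bruhatG cU) card_szB. Qed.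

Lemma szG_not_dvd3 : ~~ (3 %| #|G|)%N.
Proof.
have [k qk] : exists k, q = (3 * k + 2)%N.
  exists (q %/ 3)%N; rewrite [LHS](divn_eq _ 3) mulnC; congr (_ + _)%N.
  rewrite /sz_q addn1 expnS expnM -modnMmr -modnXm.
  by rewrite [(2 ^ 2 %% 3)%N]/= exp1n.
by rewrite card_szG qk not_dvd3_arith.
Qed.

Lemma sz_r_le : (sz_r n <= q)%N.
Proof. by rewrite leq_exp2l //; lia. Qed.

Lemma sz_r_sqr : (sz_r n ^ 2 = 2 * q)%N.
Proof. by rewrite -expnM -expnS; congr expn; lia. Qed.

Lemma sz_alpha_beta : (sz_alpha n * sz_beta n = q ^ 2 + 1)%N.
Proof.
rewrite /sz_alpha /sz_beta; have := sz_r_sqr; have := sz_r_le.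
by move: (sz_r n) q => r p /subnK <-; move: (p - r)%N => d; rewrite addnK; lia.
Qed.

Lemma kappa_Suzuki :
  kappa_C (Suzuki F n) =
    ((2 ^ ((q - 1) ^ 2) * q ^ (q ^ 2 + q - 3)) ^ (q ^ 2 + 1)
     * (q - 1) ^ ((q - 3) * (q ^ 2 * (q ^ 2 + 1) %/ 2))
     * sz_alpha n ^ ((sz_alpha n - 2) * (q ^ 2 * (q - 1) * sz_beta n %/ 4))
     * sz_beta n ^ ((sz_beta n - 2) * (q ^ 2 * (q - 1) * sz_alpha n %/ 4)))%N.
Proof.
have szRc : {in R, forall x, coprime #[x]%g (q ^ 2 * (q - 1))}.
  by move=> x Rx; rewrite -card_szB; apply: szR_coprime.
have sRG : R \subset (G^#)%g by apply: subsetDl.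
have cR : (2 * #|R| = q ^ 3 * (q - 1) ^ 2)%N.
  exact: (card_regular_set q7 qE frobB sBG WG W2 abH invHW sBBW bruhatG cU cH).
have [x [y [[Rx Ry dR dxy] [cx cy nx ny]]]] := regular_two_classes q7 qE szG_not_dvd3
  card_szG cR sRG szR_J szR_cent szRc szR_abelian szR_conj_le4
  sz_r_le sz_r_sqr.
have tU := normedTI_U frobB sBG sBBW bruhatG.
have tH := normedTI_H q7 qE frobB sBG W2 abH invHW sBBW bruhatG cH.
have cent1R z : z \in R -> {in 'C_G[z]^#, forall t, 'C_G[t] \subset 'C_G[z]}%g.
  by move=> Rz t Ct; rewrite (regular_cent_eq sRG szR_cent szR_abelian Rz Ct).
have cent1H t : t \in (H^#)%g -> ('C_G[t] \subset H)%g.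
  by move=> Ht; rewrite (cent1_H q7 qE frobB sBG W2 abH invHW sBBW bruhatG cH Ht).
have tR z (Rz : z \in R) := regular_normedTI sRG szR_cent szR_abelian Rz.
have sG (D : {group gl}) : D \subset B -> D \subset G by move/subset_trans; apply.
rewrite Suzuki_szG (kappa_rank_one (G := G) (U := U) (H := H) (A1 := 'C_G[x]%G) (A2 := 'C_G[y]%G)
  (LU := B) (LH := 'N_G(H)%G) (L1 := 'N_G('C_G[x])%G) (L2 := 'N_G('C_G[y])%G)) //; first last.
- exact: (class_support_UH_disjoint _ frobB).
- by split=> //; apply: tR.
- split; [|exact: cent1H|exact: cent1R|exact: cent1R].
  by move=> t; apply: (cent1_U frobB sBG sBBW bruhatG).
- split; try exact: subsetIl; apply: sG; [exact: joing_subl | exact: joing_subr].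
have indexG (D : {group gl}) :
    (#|'N_G(D)%g| * #|G : 'N_G(D)|%g = q ^ 2 * (q - 1) * (q ^ 2 + 1))%N.
  by rewrite Lagrange ?subsetIl // card_szG.
have -> : (\prod_(X in (U :^: G)%g) kappa_C X =
    (2 ^ ((q - 1) ^ 2) * q ^ (q ^ 2 + q - 3)) ^ (q ^ 2 + 1))%N.
  have normU : ('N_G(U) = B)%g.
    by have /and3P[_ _ /eqP] := tU; rewrite normD1.
  have <- : (#|(U :^: G)%g| = q ^ 2 + 1)%N.
    rewrite card_conjugates; have := indexG U; rewrite normU card_szB.
    by move/eqP; rewrite eqn_pmul2l => [/eqP|] //; rewrite -card_szB.
  rewrite -prod_nat_const; apply: eq_bigr => X /imsetP[g _ ->].
  exact: kappa_szU.
have iH : #|G : 'N_G(H)|%g = (q ^ 2 * (q ^ 2 + 1) %/ 2)%N.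
  apply: (@sz_torus_index q); first exact: leq_trans q7.
  rewrite -(card_norm_H frobB sBG WG W2 invHW sBBW bruhatG cH).
  exact: indexG.
have ix : #|G : 'N_G('C_G[x])|%g = (q ^ 2 * (q - 1) * sz_beta n %/ 4)%N.
  apply: (sz_cyclic_index (m := sz_alpha n)); [by rewrite /sz_alpha addn1 | exact: sz_alpha_beta |].
  by rewrite -[sz_alpha n]cx -nx indexG.
have iy : #|G : 'N_G('C_G[y])|%g = (q ^ 2 * (q - 1) * sz_alpha n %/ 4)%N.
  apply: (sz_cyclic_index (m := sz_beta n)); first by rewrite /sz_beta addn1.
    by rewrite mulnC sz_alpha_beta.
  by rewrite -[sz_beta n]cy -ny indexG.
rewrite (kappa_conjugates_abelian G abH) (kappa_conjugates_abelian G (szR_abelian Rx)).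
rewrite (kappa_conjugates_abelian G (szR_abelian Ry)) cH cx cy iH ix iy -subnDA -!expnM.
by [].
Qed.

End SuzukiTrees.

Local Close Scope ring_scope.

Theorem theorem3p10 (n : nat) (F : finFieldType) :
  (1 <= n)%N -> #|F| = sz_q n ->
  let q := sz_q n in
  let al := sz_alpha n in
  let be := sz_beta n in
  let a := q ^ 2 * (q ^ 2 + 1) %/ 2 in
  let b := q ^ 2 * (q - 1) * be %/ 4 in
  let c := q ^ 2 * (q - 1) * al %/ 4 in
  kappa_C (Suzuki F n) =
    ((2 ^ ((q - 1) ^ 2) * q ^ (q ^ 2 + q - 3)) ^ (q ^ 2 + 1)
     * (q - 1) ^ ((q - 3) * a)
     * al ^ ((al - 2) * b)
     * be ^ ((be - 2) * c))%N.
Proof. by move=> n_gt0 cardF; exact: kappa_Suzuki n_gt0 cardF. Qed.
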